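(* Assume the setup of the context, that $\mu$ is not a Dirac mass, and that the limit defining $\chi(v)$ exists for every admissible $v$. Let $v_0$ be admissible and $E_0=\chi(v_0)$. Then for every compact $K\subset\mathbb R^m$ and every $\varepsilon>0$ there exists $\eta>0$ such that for every $E\in\mathbb R^{d^+\times d^-}$ of full rank $\min\{d^+,d^-\}$ with $\|E-E_0\|<\eta$ there exists an admissible $v$ with $\|v-v_0\|_{C^r(K)}<\varepsilon$ and $\chi(v)=E$.
   Context: Let $r\ge1$, $\Lambda\subset\mathbb R^m$ compact, and $g\in C^r(\mathbb R^m,\mathbb R^m)$ such that $\Lambda$ is invariant under the flow $g_t$ of $\dot y=g(y)$. Let $\mu$ be a Borel probability measure on $\Lambda$ that is $g_t$-invariant, ergodic and mixing. Let $R\in\mathbb R^{m\times m}$ with $R^2=I$, $R(\Lambda)=\Lambda$, $\mu$ $R$-invariant, and $g(Ry)=-Rg(y)$ for all $y\in\Lambda$. Let $d=d^++d^-$ and $A=\mathrm{diag}(I_{d^+},-I_{d^-})$. A function $v\in C^r(\mathbb R^m,\mathbb R^d)$ is admissible if $v(Ry)=Av(y)$ for all $y\in\Lambda$ and $\int_\Lambda v\,d\mu=0$; write $v=(v^+,v^-)$ with $v^\pm$ valued in $\mathbb R^{d^\pm}$ and set $\chi(v)=2\lim_{T\to\infty}\int_0^T\int_\Lambda v^+\otimes(v^-\circ g_t)\,d\mu\,dt\in\mathbb R^{d^+\times d^-}$, where $u\otimes w=uw^T$. $\|w\|_{C^r(K)}$ is the supremum over $K$ of all partial derivatives of $w$ of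 order $0,\dots,r$. *)

(* Defs.v *)
From HB Require Import structures.
From mathcomp Require Import all_boot all_order all_algebra.
From mathcomp Require Import all_classical all_reals all_analysis.
Set Implicit Arguments. Unset Strict Implicit. Unset Printing Implicit Defensive.
Import Order.TTheory GRing.Theory Num.Theory.
Import numFieldNormedType.Exports.
Local Open Scope classical_set_scope.
Local Open Scope ring_scope.

Definition BorelcV (R : realType) (m : nat) : Type :=
  g_sigma_algebraType (@open 'cV[R]_m).

Definition ecv {R : realType} {m : nat} (i : 'I_m) : 'cV[R]_m := delta_mx i 0.

Definition partial {R : realType} {m n : nat} (i : 'I_m)
  (f : 'cV[R]_m -> 'cV[R]_n) : 'cV[R]_m -> 'cV[R]_n :=
  fun x => derive f x (ecv i).

Fixpoint Cr {R : realType} {m n : nat} (r : nat)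
  (f : 'cV[R]_m -> 'cV[R]_n) : Prop :=
  match r with
  | 0 => continuous f
  | r'.+1 => [/\ continuous f, (forall i x, derivable f x (ecv i))
             & forall i, Cr r' (partial i f)]
  end.

Fixpoint iter_partial {R : realType} {m n : nat} (s : seq 'I_m)
  (f : 'cV[R]_m -> 'cV[R]_n) : 'cV[R]_m -> 'cV[R]_n :=
  match s with
  | [::] => f
  | i :: s' => partial i (iter_partial s' f)
  end.

(* ||w||_{C^r(K)} < eps, where ||w||_{C^r(K)} is the supremum over K of the
   absolute values of all partial derivatives of order 0..r of all components
   of w.  (sup < eps  <=>  exists c < eps bounding all of them.) *)
Definition CrK_norm_lt {R : realType} {m n : nat} (r : nat) (K : set 'cV[R]_m)
  (w : 'cV[R]_m -> 'cV[R]_n) (eps : R) : Prop :=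
  exists2 c : R, c < eps &
    forall s : seq 'I_m, (size s <= r)%N ->
    forall x, K x -> forall k : 'I_n, `| iter_partial s w x k 0 | <= c.

Definition is_flow_on {R : realType} {m : nat} (g : 'cV[R]_m -> 'cV[R]_m)
  (Lam : set 'cV[R]_m) (phi : R -> 'cV[R]_m -> 'cV[R]_m) : Prop :=
  forall y, Lam y ->
    phi 0 y = y /\
    forall t : R, [/\ Lam (phi t y),
                      derivable (fun s : R => phi s y) t 1
                    & derive (fun s : R => phi s y) t 1 = g (phi t y)].

(* mu is invariant under the flow (restricted to Lam, which carries mu) *)
Definition flow_invariant {R : realType} {m : nat}
  (mu : probability (BorelcV R m) R) (Lam : set 'cV[R]_m)
  (phi : R -> 'cV[R]_m -> 'cV[R]_m) : Prop :=
  forall (A : set (BorelcV R m)), measurable A ->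
    forall t : R, mu (Lam `&` (phi t @^-1` A)) = mu A.

Definition flow_ergodic {R : realType} {m : nat}
  (mu : probability (BorelcV R m) R) (Lam : set 'cV[R]_m)
  (phi : R -> 'cV[R]_m -> 'cV[R]_m) : Prop :=
  forall (A : set (BorelcV R m)), measurable A ->
    (forall t : R, Lam `&` (phi t @^-1` A) = Lam `&` A) ->
    mu A = 0%E \/ mu A = 1%E.

Definition flow_mixing {R : realType} {m : nat}
  (mu : probability (BorelcV R m) R) (Lam : set 'cV[R]_m)
  (phi : R -> 'cV[R]_m -> 'cV[R]_m) : Prop :=
  forall (A B : set (BorelcV R m)), measurable A -> measurable B ->
    (mu (A `&` (Lam `&` (phi t @^-1` B))) @[t --> +oo%R] --> (mu A * mu B)%E).

Definition is_dirac {R : realType} {m : nat}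
  (mu : probability (BorelcV R m) R) : Prop :=
  exists y : BorelcV R m, forall A : set (BorelcV R m), measurable A ->
    mu A = (\d_ y)%R A.

Definition Amat {R : realType} (dp dm : nat) : 'M[R]_(dp + dm) :=
  block_mx 1%:M 0 0 (- 1%:M).

Definition admissible {R : realType} {m : nat} (r : nat) (Lam : set 'cV[R]_m)
  (mu : probability (BorelcV R m) R) (Rm : 'M[R]_m) (dp dm : nat)
  (v : 'cV[R]_m -> 'cV[R]_(dp + dm)) : Prop :=
  [/\ Cr r v,
      (forall y, Lam y -> v (Rm *m y) = Amat dp dm *m v y)
    & forall k : 'I_(dp + dm), Rintegral mu Lam (fun y => v y k 0) = 0].

Definition chi_partial {R : realType} {m : nat} (Lam : set 'cV[R]_m)
  (mu : probability (BorelcV R m) R) (phi : R -> 'cV[R]_m -> 'cV[R]_m)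
  (dp dm : nat) (v : 'cV[R]_m -> 'cV[R]_(dp + dm)) (i : 'I_dp) (j : 'I_dm)
  (T : R) : R :=
  Rintegral (@lebesgue_measure R) `[0%R, T]%classic
    (fun t : R => Rintegral mu Lam
       (fun y => usubmx (v y) i 0 * dsubmx (v (phi t y)) j 0)).

Definition chi {R : realType} {m : nat} (Lam : set 'cV[R]_m)
  (mu : probability (BorelcV R m) R) (phi : R -> 'cV[R]_m -> 'cV[R]_m)
  (dp dm : nat) (v : 'cV[R]_m -> 'cV[R]_(dp + dm)) : 'M[R]_(dp, dm) :=
  \matrix_(i < dp, j < dm)
    (2 * lim (chi_partial Lam mu phi v i j T @[T --> +oo%R])).

(* Main.v *)
Require Import Defs.
From HB Require Import structures.
From mathcomp Require Import all_boot all_order all_algebra.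
From mathcomp Require Import all_classical all_reals all_analysis.
From mathcomp Require Import measurable_realfun ring lra zify.
Import Order.TTheory GRing.Theory Num.Theory.
Import numFieldNormedType.Exports.
Local Open Scope classical_set_scope.
Local Open Scope ring_scope.
Set Implicit Arguments.
Unset Strict Implicit.
Unset Printing Implicit Defensive.

(* Let green_kubo a c = 2 lim_T int_0^T int a (c o phi_t) dmu dt, a bilinear
   pairing of even mean-zero observables with odd ones. If L is the derivative
   along the flow of an even function F, then L is odd, the time integral
   telescopes, and mixing gives green_kubo a L = - 2 int a F. Mixing also forces mu,
   not being a Dirac mass, to have no atoms; hence some even polynomial F has a
   law which is not finitely supported, and the centred powers of F have an
   invertible Gram matrix of any size. So the pairing has infinite rank, and there
   are p_i (even) and q_k (odd) which are dual to each other while p is orthogonal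
   to v0^- and q to v0^+. For v^+ = v0^+ + s p and
   v^- = v0^- + s^-1 (E - E0)^T q one gets chi(v) = E0 + s s^-1 (E - E0) = E, and
   both perturbations are O(s) as soon as |E - E0| < s^2. *)

(** * Real-valued C^r functions *)

(** The flow is described only along single trajectories in [Lam]. Dependence on the initial point
    is therefore obtained from Gronwall's inequality, so that [phi t] is measurable on [Lam] and
    correlations make sense. Mixing is a statement about sets and reaches functions through uniform
    approximation by step functions. F is taken polynomial because g is only C^r: the derivative of
    F along the flow is then a polynomial in the coordinates of [y] and [g y], still C^r, whereas a
    general C^r function would lose a derivative. Since chi is bilinear in (v^+, v^-), moving only
    one of the two parts cannot work in general: for v0 = 0 it leaves chi at 0. Moving both creates
    two cross terms with v0. The orthogonality relations remove exactly these, so only the product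
    of the two perturbations survives and chi(v) = E is solved exactly, without an implicit function
    argument. A Gram matrix of size 2 d^+ + d^- leaves enough room for these relations. *)

Section continuous_real.
Context {R : realType} {T : topologicalType}.
Implicit Types f h : T -> R.

Lemma continuous_add f h : continuous f -> continuous h ->
  continuous (fun y => f y + h y).
Proof. by move=> cf ch x; apply: cvgD; [exact: cf|exact: ch]. Qed.

Lemma continuous_mul f h : continuous f -> continuous h ->
  continuous (fun y => f y * h y).
Proof. by move=> cf ch x; apply: cvgM; [exact: cf|exact: ch]. Qed.

End continuous_real.

Section scalar_Cr.
Context {R : realType} {m : nat}.
Implicit Types (f h : 'cV[R]_m -> R) (r : nat).

(** Scalar counterpart of [Cr], where products and the Leibniz rule are available; [CrP] carries the
    results over to vector-valued maps. *)
Fixpoint Cr1 r f : Prop :=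
  match r with
  | 0 => continuous f
  | r'.+1 => [/\ continuous f, (forall i x, derivable f x (ecv i))
             & forall i, Cr1 r' (fun x => 'D_(ecv i) f x)]
  end.

Lemma Cr1_continuous r f : Cr1 r f -> continuous f.
Proof. by case: r => [//|r] []. Qed.

Lemma Cr1W r f : Cr1 r.+1 f -> Cr1 r f.
Proof.
elim: r f => [f []//|r IH f [cf df Df]]; split => // i.
by apply: IH; exact: Df.
Qed.

Lemma Cr1_cst r (k : R) : Cr1 r (fun=> k).
Proof.
elim: r k => [k|r IH k] /=; first exact: cst_continuous.
split; [exact: cst_continuous|by move=> i x; exact: derivable_cst|move=> i].
have := IH 0; congr Cr1.
by apply/funext => x; exact/esym/derive_cst.
Qed.

Lemma Cr1D r f h : Cr1 r f -> Cr1 r h -> Cr1 r (fun y => f y + h y).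
Proof.
elim: r f h => /= [f h cf ch|r IH f h [cf df Df] [ch dh Dh]].
  exact: continuous_add.
split; first exact: continuous_add.
  by move=> i x; exact: (derivableD (df i x) (dh i x)).
move=> i; have := IH _ _ (Df i) (Dh i); congr Cr1.
by apply/funext => x; rewrite -deriveD.
Qed.

Lemma Cr1M r f h : Cr1 r f -> Cr1 r h -> Cr1 r (fun y => f y * h y).
Proof.
elim: r f h => [f h cf ch|r IH f h Cf Ch].
  exact: continuous_mul.
have [[cf df Df] [ch dh Dh]] := (Cf, Ch).
split; first exact: continuous_mul.
  by move=> i x; exact: (derivableM (df i x) (dh i x)).
move=> i; have : Cr1 r (fun y => f y * 'D_(ecv i) h y + h y * 'D_(ecv i) f y).
  by apply: Cr1D; [exact: (IH _ _ (Cr1W Cf) (Dh i))|exact: (IH _ _ (Cr1W Ch) (Df i))].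
by congr Cr1; apply/funext => x; rewrite -[LHS]deriveM.
Qed.

Lemma Cr1Z r k f : Cr1 r f -> Cr1 r (fun y => k * f y).
Proof. by apply: Cr1M; exact: Cr1_cst. Qed.

Lemma Cr1_sum (I : Type) (s : seq I) r (F : I -> 'cV[R]_m -> R) :
  (forall i, Cr1 r (F i)) -> Cr1 r (fun y => \sum_(i <- s) F i y).
Proof.
move=> CF; elim: s => [|i s IH].
  by under eq_fun do rewrite big_nil; exact: Cr1_cst.
by under eq_fun do rewrite big_cons; exact: Cr1D.
Qed.

Lemma Cr1_coord r k : Cr1 r (fun y => y k 0).
Proof.
have D i x : is_derive x (ecv i) (fun y : 'cV[R]_m => y k 0) (ecv i k 0).
  have dfd : derivable (@id 'cV[R]_m) x (ecv i) by exact: derivable_id.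
  split; first by move/derivable_mxP : dfd; exact.
  by have := derive_mx dfd; rewrite derive_id => /matrixP/(_ k 0) ->; rewrite mxE.
case: r => [|r]; first exact: coord_continuous.
split; first exact: coord_continuous.
  by move=> i x; have [] := D i x.
move=> i; have := @Cr1_cst r ((ecv i : 'cV[R]_m) k 0); congr Cr1.
by apply/funext => x; have [_ ->] := D i x.
Qed.

Lemma Cr1_mulmx r n (M : 'M[R]_(n, m)) k : Cr1 r (fun y => (M *m y) k 0).
Proof.
under eq_fun do rewrite mxE.
by apply: Cr1_sum => j; apply: Cr1Z; exact: Cr1_coord.
Qed.

End scalar_Cr.

Section vector_Cr.
Context {R : realType} {m n : nat}.
Implicit Types (v : 'cV[R]_m -> 'cV[R]_n) (r : nat).

Lemma continuous_colP (T : topologicalType) (w : T -> 'cV[R]_n) (x : T) :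
  {for x, continuous w} <-> forall k, {for x, continuous (fun y => w y k 0)}.
Proof.
split=> [cw k|cw].
  exact: (continuous_comp cw (@coord_continuous _ _ _ k 0 (w x))).
apply/cvgrPdist_le => /= e e0.
near=> t.
rewrite /Num.Def.normr/= mx_normrE (bigmax_le _ (ltW e0))//= => i _.
rewrite !mxE [i.2]ord1/=.
move: i; near: t; apply: filter_forall => /= i.
by apply: ((cvgrPdist_le _ _).1 (cw i.1)).
Unshelve. all: by end_near. Qed.

Lemma derive_coord (w : 'cV[R]_m -> 'cV[R]_n) x u k : derivable w x u ->
  'D_u w x k 0 = 'D_u (fun y => w y k 0) x.
Proof. by move=> /derive_mx ->; rewrite mxE. Qed.

Lemma CrP r v : Cr r v <-> forall k, Cr1 r (fun y => v y k 0).
Proof.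
elim: r v => [v|r IH v] /=.
  split=> [cv k x|cv x]; first by apply: ((continuous_colP _ _).1 (cv x)).
  by apply/continuous_colP => k; exact: cv.
split=> [[cv dv Dv] k|Cv].
  split; first by move=> x; apply: ((continuous_colP _ _).1 (cv x)).
    by move=> i x; exact: ((derivable_mxP _ _ _).1 (dv i x)).
  move=> i; have /IH/(_ k) := Dv i; congr Cr1.
  by apply/funext => x; rewrite /partial derive_coord.
have dv i x : derivable v x (ecv i).
  by apply/derivable_mxP => k j; rewrite [j]ord1; have [_ + _] := Cv k; exact.
split=> //.
  by move=> x; apply/continuous_colP => k; have [+ _ _] := Cv k; exact.
move=> i; apply/IH => k; have [_ _ /(_ i)] := Cv k; congr Cr1.
by apply/funext => x; rewrite /partial derive_coord.
Qed.

End vector_Cr.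

(** * Bounds on iterated partial derivatives over a compact set *)

Section iterated_partials.
Context {R : realType} {m : nat}.
Implicit Types (f h : 'cV[R]_m -> R) (r : nat) (s : seq 'I_m).

Fixpoint iter_partial1 s f : 'cV[R]_m -> R :=
  match s with
  | [::] => f
  | i :: s' => fun x => 'D_(ecv i) (iter_partial1 s' f) x
  end.

(** [Cr] and [Cr1] peel off the derivative taken first, which is the last entry of the list, while
    iterated partials unfold the derivative taken last. Hence the inductions on smoothness below
    treat lists from their end. *)
Lemma iter_partial1_rcons s i f :
  iter_partial1 (rcons s i) f = iter_partial1 s (fun x => 'D_(ecv i) f x).
Proof. by elim: s => //= j s ->. Qed.

Lemma iter_partial_rcons n s i (w : 'cV[R]_m -> 'cV[R]_n) :
  iter_partial (rcons s i) w = iter_partial s (partial i w).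
Proof. by elim: s => //= j s ->. Qed.

Lemma iter_partial_coord n r s (w : 'cV[R]_m -> 'cV[R]_n) k x : Cr r w ->
  (size s <= r)%N -> iter_partial s w x k 0 = iter_partial1 s (fun y => w y k 0) x.
Proof.
elim/last_ind: s r w => // s i IH [|r] w; rewrite size_rcons// ltnS => -[cw dw Dw] sr.
rewrite iter_partial_rcons iter_partial1_rcons (IH r _ (Dw i) sr).
by congr (iter_partial1 _ _ _); apply/funext => y; rewrite /partial derive_coord.
Qed.

Definition partials_bounded r (K : set 'cV[R]_m) f (M : R) :=
  forall s, (size s <= r)%N -> forall x, K x -> `|iter_partial1 s f x| <= M.

Lemma Cr1_partials_bounded r (K : set 'cV[R]_m) f : compact K -> Cr1 r f ->
  exists M, partials_bounded r K f M.
Proof.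
move=> cK.
have bnd h : continuous h -> exists M, forall x, K x -> `|h x| <= M.
  move=> ch; have : compact (h @` K).
    by apply: continuous_compact => //; exact: continuous_subspaceT.
  move=> /compact_bounded[M [Mr MK]]; exists (M + 1) => x Kx.
  by apply: MK; [rewrite ltrDl|exists x].
elim: r f => [f cf|r IH f [cf df Df]].
  by have [M MK] := bnd _ cf; exists M => -[].
have [M0 M0K] := bnd _ cf.
have /choice[M MK] : forall i, exists M, partials_bounded r K ('D_(ecv i) f) M.
  by move=> i; exact: (IH _ (Df i)).
exists (\big[Num.max/M0]_i M i); case/lastP => [_ x Kx|s i].
  by rewrite (le_trans (M0K _ Kx))// bigmax_ge_id.
rewrite size_rcons ltnS => sr x Kx; rewrite iter_partial1_rcons.
by rewrite (le_trans (MK i s sr x Kx))// le_bigmax.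
Qed.

Lemma iter_partial1_lin r s k f h : Cr1 r f -> Cr1 r h -> (size s <= r)%N ->
  iter_partial1 s (fun y => k * f y + h y) =
  fun y => k * iter_partial1 s f y + iter_partial1 s h y.
Proof.
elim/last_ind: s r f h => // s i IH [|r] f h; rewrite size_rcons// ltnS.
move=> [cf df Df] [ch dh Dh] sr.
rewrite !iter_partial1_rcons -(IH r _ _ (Df i) (Dh i) sr); congr iter_partial1.
apply/funext => x.
have -> : (fun y => k * f y + h y) = k *: f + h by [].
by rewrite deriveD ?deriveZ//; exact: derivableZ.
Qed.

Lemma partials_bounded_lin r K k f h (Mf Mh : R) : Cr1 r f -> Cr1 r h ->
  partials_bounded r K f Mf -> partials_bounded r K h Mh ->
  partials_bounded r K (fun y => k * f y + h y) (`|k| * Mf + Mh).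
Proof.
move=> Cf Ch bf bh s sr x Kx; rewrite (iter_partial1_lin k Cf Ch sr).
rewrite (le_trans (ler_normD _ _))// normrM lerD//; last exact: bh.
by apply: ler_wpM2l => //; exact: bf.
Qed.

Lemma partials_bounded0 r K : partials_bounded r K (fun=> 0) 0.
Proof.
move=> s _ x _; suff -> : iter_partial1 s (fun=> 0) = (fun=> 0) by rewrite normr0.
by elim: s => //= i s ->; apply/funext => y; exact: derive_cst.
Qed.

Lemma partials_bounded_sum r K (I : Type) (s : seq I) (k : I -> R)
    (F : I -> 'cV[R]_m -> R) (M : I -> R) :
  (forall i, Cr1 r (F i)) -> (forall i, partials_bounded r K (F i) (M i)) ->
  partials_bounded r K (fun y => \sum_(i <- s) k i * F i y)
    (\sum_(i <- s) `|k i| * M i).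
Proof.
move=> CF bF; elim: s => [|i s IH].
  by rewrite big_nil; under eq_fun do rewrite big_nil; exact: partials_bounded0.
rewrite big_cons; under eq_fun do rewrite big_cons.
apply: partials_bounded_lin => //.
by apply: Cr1_sum => j; apply: Cr1Z.
Qed.

End iterated_partials.

(** * Mean value and Gronwall inequalities *)

Lemma mx_norm_coord (R : realType) (p q : nat) (A : 'M[R]_(p, q)) i j :
  `|A i j| <= `|A|.
Proof.
rewrite [leRHS]/Num.Def.normr/= mx_normrE.
exact: (le_bigmax _ (fun ij : 'I_p * 'I_q => `|A ij.1 ij.2|) (i, j)).
Qed.

Section column_norm.
Context {R : realType} {m : nat}.
Implicit Types (x y : 'cV[R]_m).

Lemma cV_norm_le x (M : R) : 0 <= M -> (forall i, `|x i 0| <= M) -> `|x| <= M.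
Proof.
move=> M0 xM; rewrite /Num.Def.normr/= mx_normrE.
by apply: bigmax_le => // -[i j] _ /=; rewrite [j]ord1.
Qed.

(** In the sup norm the ball is a product of segments; compactness of such boxes is carried over
    from row vectors by transposition. *)
Lemma cV_ball_compact (M : R) : compact [set x : 'cV[R]_m | `|x| <= M].
Proof.
have [M0|M0] := ltP M 0.
  rewrite (_ : mkset _ = set0); first exact: compact0.
  by rewrite -subset0 => x /= xM; have := le_lt_trans xM M0; rewrite normr_lt0.
have -> : [set x : 'cV[R]_m | `|x| <= M] =
    trmx @` [set v : 'rV[R]_m | forall i, `[- M, M]%classic (v ord0 i)].
  apply/seteqP; split=> [x /= xM|_ [v /= vM <-]].
    exists x^T; last by rewrite trmxK.
    by move=> i; rewrite mxE /= in_itv/= -ler_norml (le_trans (mx_norm_coord x i 0)).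
  apply: cV_norm_le => // i; rewrite mxE ler_norml.
  by have := vM i; rewrite in_itv.
apply: continuous_compact; last first.
  exact: (@rV_compact R m (fun=> `[- M, M]%classic) (fun=> @segment_compact R (- M) M)).
apply: continuous_subspaceT => v; apply/continuous_colP => k.
have := @coord_continuous R 1 m 0 k v; congr (continuous_at _ _).
by apply/funext => w; rewrite mxE.
Qed.

End column_norm.

Section mean_value.
Context {R : realType}.

Lemma mean_value_bound (u u' : R -> R) (C a b : R) :
  (forall t : R, is_derive t 1 u (u' t)) ->
  (forall t, Num.min a b <= t <= Num.max a b -> `|u' t| <= C) ->
  `|u b - u a| <= C * `|b - a|.
Proof.
move=> du uC; wlog ab : a b uC / a <= b.
  move=> H; have [/H|/ltW ba] := leP a b; first exact.
  by rewrite distrC [in leRHS]distrC; apply: H => // t; rewrite minC maxC; exact: uC.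
rewrite min_l// max_r// in uC.
have cu : continuous u.
  by move=> t; apply/differentiable_continuous/derivable1_diffP; have [] := du t.
have [c cab ->] := MVT_segment ab (fun t _ => du t) (continuous_subspaceT cu).
by rewrite normrM ler_wpM2r// uC//; move: cab; rewrite in_itv.
Qed.

(** [expR (- c * s) * S s] is nonincreasing. The bound on |S'| is two-sided, so negative times
    follow by applying the same argument to [S (- s)]. *)
Lemma gronwall (S S' : R -> R) (c : R) :
  (forall t : R, is_derive t 1 S (S' t)) -> (forall t, `|S' t| <= c * S t) ->
  forall t, S t <= expR (c * `|t|) * S 0.
Proof.
have pos (U U' : R -> R) : (forall t : R, is_derive t 1 U (U' t)) ->
    (forall t, `|U' t| <= c * U t) ->
    forall t, 0 <= t -> U t <= expR (c * t) * U 0.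
  move=> dU Uc t t0.
  pose h (s : R) := expR (- c * s) * U s.
  have dh (s : R) : is_derive s 1 h (expR (- c * s) * (U' s - c * U s)).
    have de : is_derive s 1 (fun s : R => expR (- c * s)) (expR (- c * s) * - c).
      apply: is_derive1_comp.
      by apply: is_derive_eq; rewrite /GRing.scale/= mulr1.
    by apply: is_derive_eq; rewrite /GRing.scale/=; ring.
  have ch : continuous h.
    by move=> s; apply/differentiable_continuous/derivable1_diffP; have [] := dh s.
  have := @ler0_derive1_nincr _ h 0 t _ _ (continuous_subspaceT ch) 0 t (lexx _) t0 (lexx _).
  rewrite /h mulr0 expR0 mul1r mulNr expRN => H.
  rewrite -ler_pdivrMl ?expR_gt0//; apply: H => s _; first by have [] := dh s.
  rewrite derive1E; have [_ ->] := dh s.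
  by rewrite pmulr_rle0 ?expR_gt0// subr_le0 (le_trans (ler_norm _)).
move=> dS Sc t; have [t0|/ltW t0] := leP 0 t; first by rewrite ger0_norm//; exact: pos.
rewrite ler0_norm//.
have := @pos (fun s => S (- s)) (fun s => - S' (- s)) _ _ (- t).
rewrite opprK oppr0 oppr_ge0; apply=> // s; last by rewrite normrN.
have dN : is_derive s 1 (fun s : R => - s) (-1) by exact: is_deriveN.
have := @is_derive1_comp _ S _ s (S' (- s)) (-1) (dS _) dN.
by rewrite mulrN1.
Qed.

End mean_value.

Section lipschitz.
Context {R : realType} {m : nat}.

(** Pass from x to y one coordinate at a time. Each move is a one-variable mean value estimate on a
    segment inside the sup-norm ball, so bounds on the partial derivatives suffice; m moves give the
    constant m C. *)
Lemma Cr1_lipschitz (f : 'cV[R]_m -> R) (M : R) : Cr1 1 f ->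
  exists2 L, 0 <= L & forall x y, `|x| <= M -> `|y| <= M ->
    `|f x - f y| <= L * `|x - y|.
Proof.
move=> Cf; have [C0 C0f] := Cr1_partials_bounded (@cV_ball_compact R m M) Cf.
pose C := Num.max 0 C0.
have Cf' i (x : 'cV[R]_m) : `|x| <= M -> `|'D_(ecv i) f x| <= C.
  by move=> xM; rewrite /C le_max (C0f [:: i])// orbT.
have C_ge0 : 0 <= C by rewrite /C le_max lexx.
exists (m%:R * C); first by rewrite mulr_ge0.
(* The points may differ only in their first [k] coordinates; the induction step corrects the
   coordinate of index [k]. *)
suff H : forall k, (k <= m)%N -> forall x y : 'cV[R]_m, `|x| <= M -> `|y| <= M ->
    (forall i : 'I_m, (k <= i)%N -> x i 0 = y i 0) ->
    `|f x - f y| <= k%:R * C * `|x - y|.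
  by move=> x y xM yM; apply: H => // i; rewrite leqNgt ltn_ord.
elim=> [_ x y _ _ xy|k IH km x y xM yM xy].
  suff -> : x = y by rewrite !subrr !normr0 mulr0.
  by apply/colP => i; exact: xy.
have M0 : 0 <= M by rewrite (le_trans _ xM).
pose i := Ordinal km.
pose w (t : R) : 'cV[R]_m := x + (t - x i 0) *: ecv i.
have wE t j : w t j 0 = if j == i then t else x j 0.
  rewrite !mxE eqxx andbT; case: eqVneq => [->|_]; last by rewrite mulr0n mulr0 addr0.
  by rewrite mulr1n mulr1 addrC subrK.
have wx : w (x i 0) = x by rewrite /w subrr scale0r addr0.
have wy t : `|t| <= M -> `|w t| <= M.
  move=> tM; apply: cV_norm_le => // j; rewrite wE; case: ifP => // _.
  exact: le_trans (mx_norm_coord _ _ _) xM.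
have du (t : R) : is_derive t 1 (fun s => f (w s)) ('D_(ecv i) f (w t)).
  (* [w] moves with unit speed in direction [ecv i], so the two difference quotients coincide and no
     chain rule is invoked. *)
  have E : (fun h : R => h^-1 *: (((fun s => f (w s)) \o shift t) (h *: (1 : R)) - f (w t)))
         = (fun h : R => h^-1 *: ((f \o shift (w t)) (h *: ecv i) - f (w t))).
    apply/funext => h /=; congr (_ *: (f _ - _)).
    by rewrite /w addrCA -scalerDl; congr (_ + _ *: _); rewrite [h *: _]mulr1 addrA.
  have [_ /(_ i (w t)) dfw _] := Cf.
  by apply: DeriveDef; [rewrite /derivable E|rewrite /derive E].
have step : `|f (w (y i 0)) - f (w (x i 0))| <= C * `|y i 0 - x i 0|.
  apply: (mean_value_bound du) => t /andP[t1 t2]; apply: Cf'; apply: wy.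
  have xi := le_trans (mx_norm_coord x i 0) xM.
  have yi := le_trans (mx_norm_coord y i 0) yM.
  move: xi yi t1 t2; rewrite !ler_norml => /andP[x1 x2] /andP[y1 y2].
  rewrite ge_min le_max => /orP t1 /orP t2; apply/andP; split.
    by case: t1; apply: le_trans.
  by case: t2 => /le_trans; apply.
rewrite wx in step.
have zy : `|f (w (y i 0)) - f y| <= k%:R * C * `|w (y i 0) - y|.
  apply: IH => //; first exact: ltnW.
    by apply: wy; exact: le_trans (mx_norm_coord _ _ _) yM.
  move=> j kj; rewrite wE; case: eqVneq => [->//|ji].
  apply: xy; rewrite ltn_neqAle kj andbT.
  by apply: contra_neq ji => kj'; exact/val_inj.
have zy' : `|w (y i 0) - y| <= `|x - y|.
  apply: cV_norm_le => // j; rewrite mxE wE [X in _ + X]mxE.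
  case: eqVneq => [->|_]; first by rewrite subrr normr0.
  by have := mx_norm_coord (x - y) j 0; rewrite !mxE.
have xy' : `|y i 0 - x i 0| <= `|x - y|.
  by rewrite distrC; have := mx_norm_coord (x - y) i 0; rewrite !mxE.
rewrite -(subrKA (f (w (y i 0)))) (le_trans (ler_normD _ _))// -natr1.
rewrite mulrDl mulrDl mul1r addrC lerD//.
  rewrite (le_trans zy)// ler_wpM2l// mulr_ge0//.
by rewrite distrC (le_trans step)// ler_wpM2l.
Qed.

End lipschitz.

(** * Continuity of the flow *)

Section flow.
Context {R : realType} {m r : nat} {Lam : set 'cV[R]_m}
  {g : 'cV[R]_m -> 'cV[R]_m} {phi : R -> 'cV[R]_m -> 'cV[R]_m}.
Hypotheses (cLam : compact Lam) (Cg : Cr r.+1 g) (flow : is_flow_on g Lam phi).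

Lemma flow_in y t : Lam y -> Lam (phi t y).
Proof. by move=> /flow[_ /(_ t)[]]. Qed.

Lemma flow0 y : Lam y -> phi 0 y = y.
Proof. by move=> /flow[]. Qed.

Lemma flow_derive y (t : R) i : Lam y ->
  is_derive t 1 (fun s => phi s y i 0) (g (phi t y) i 0).
Proof.
move=> /flow[_ /(_ t)[_ dphi <-]]; split.
  by move/derivable_mxP : dphi; exact.
by rewrite derive_mx// mxE.
Qed.

(** Gronwall is applied to the sum [S] of squared coordinate differences of two trajectories: it is
    differentiable, which the sup norm is not, and a Lipschitz bound for g on a ball containing
    [Lam] gives |S'| <= c S. *)
Lemma flow_lipschitz t : exists2 L, 0 <= L &
  forall x y, Lam x -> Lam y -> `|phi t x - phi t y| <= L * `|x - y|.
Proof.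
have [M [Mr LM]] := compact_bounded cLam.
have {}LM x : Lam x -> `|x| <= M + 1 by apply: LM; rewrite ltrDl.
have /choice[l lP] : forall i, exists l, 0 <= l /\
    forall x y, Lam x -> Lam y -> `|g x i 0 - g y i 0| <= l * `|x - y|.
  move=> i.
  have C1 : Cr1 1 (fun y => g y i 0).
    have := (CrP _ _).1 Cg i; move: (r) => k; elim: k => // k IH Ck.
    by apply: IH; exact: Cr1W.
  have [l l0 lL] := Cr1_lipschitz (M + 1) C1.
  by exists l; split=> // x y /LM xM /LM yM; exact: lL.
pose c : R := \sum_i 2 * l i.
(* The exponential is the Gronwall factor, [m] comes from S(0) <= m |x - y|^2, and the root returns
   from [S] to the norm. *)
exists (Num.sqrt (expR (c * `|t|) * m%:R)); first exact: sqrtr_ge0.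
move=> x y Lx Ly.
pose S (s : R) : R := \sum_i (phi s x i 0 - phi s y i 0) ^+ 2.
have normS s i : `|phi s x i 0 - phi s y i 0| ^+ 2 <= S s.
  rewrite /S (bigD1 i)//= real_normK ?num_real// lerDl sumr_ge0// => j _.
  exact: sqr_ge0.
have S0 s : 0 <= S s by apply: sumr_ge0 => i _; exact: sqr_ge0.
have norm_sqr s : `|phi s x - phi s y| <= Num.sqrt (S s).
  apply: cV_norm_le => [|i]; first exact: sqrtr_ge0.
  rewrite !mxE -(@ler_pXn2r _ 2)// ?nnegrE ?sqrtr_ge0// sqr_sqrtr//.
pose S' s : R := \sum_i 2 * (phi s x i 0 - phi s y i 0) *
  (g (phi s x) i 0 - g (phi s y) i 0).
have dS (s : R) : is_derive s 1 S (S' s).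
  have -> : S = \sum_i (fun s => (phi s x i 0 - phi s y i 0) ^+ 2).
    by apply/funext => u; rewrite fct_sumE.
  apply: is_derive_sum => i.
  have dx := flow_derive s i Lx.
  have dy := flow_derive s i Ly.
  have dxy := is_deriveB dx dy.
  apply: is_derive_eq; rewrite /GRing.scale/=; ring.
have S'c s : `|S' s| <= c * S s.
  rewrite /S' /c (le_trans (ler_norm_sum _ _ _))// mulr_suml ler_sum// => i _.
  rewrite !normrM ger0_norm// -!mulrA ler_wpM2l//.
  have [l0 lL] := lP i.
  apply: (@le_trans _ _ (Num.sqrt (S s) * (l i * Num.sqrt (S s)))).
    apply: ler_pM => //.
      by apply: le_trans (norm_sqr s); have := mx_norm_coord (phi s x - phi s y) i 0; rewrite !mxE.
    rewrite (le_trans (lL _ _ (flow_in s Lx) (flow_in s Ly)))// ler_wpM2l//.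
  by rewrite mulrCA -expr2 sqr_sqrtr.
apply: (le_trans (norm_sqr t)).
rewrite -[leRHS]ger0_norm ?mulr_ge0 ?sqrtr_ge0// -sqrtr_sqr ler_wsqrtr//.
rewrite exprMn sqr_sqrtr ?mulr_ge0 ?expR_ge0//.
rewrite (le_trans (gronwall dS S'c t))// -mulrA ler_wpM2l ?expR_ge0//.
rewrite /S (le_trans (ler_sum _ (G := fun=> `|x - y| ^+ 2) _))//.
  move=> i _; rewrite !flow0// -real_normK ?num_real//.
  by rewrite lerXn2r ?nnegrE//; have := mx_norm_coord (x - y) i 0; rewrite !mxE.
by rewrite sumr_const card_ord mulr_natl.
Qed.

Lemma flow_continuous t : {within Lam, continuous (phi t)}.
Proof.
apply/subspace_continuousP => x Lx; have [L L0 LL] := flow_lipschitz t.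
apply/cvgrPdist_le => e e0; rewrite near_withinE; near=> y.
move=> Ly; rewrite (le_trans (LL _ _ Lx Ly))//.
(* [L + 1] rather than [L], which may be 0. *)
have : `|x - y| <= e / (L + 1).
  by near: y; apply: cvgr_dist_le => //; rewrite divr_gt0// ltr_wpDl.
move=> /(ler_wpM2l L0)/le_trans; apply.
by rewrite mulrCA ler_piMr ?(ltW e0)// ler_pdivrMr ?mul1r ?lerDl// ltr_wpDl.
Unshelve. all: by end_near. Qed.

End flow.

(** * Bounded measurable functions *)

Section bounded_measurable.
Context d (T : measurableType d) (R : realType) (D : set T).
Hypothesis mD : measurable D.
Implicit Types (f h : T -> R).

Definition bounded_measurable f :=
  measurable_fun D f /\ exists M : R, forall y, D y -> `|f y| <= M.

Lemma bounded_measurable_cst (k : R) : bounded_measurable (fun=> k).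
Proof. by split; [exact: measurable_cst|exists `|k|]. Qed.

Lemma bounded_measurable_mul f h : bounded_measurable f -> bounded_measurable h ->
  bounded_measurable (fun y => f y * h y).
Proof.
move=> [mf [Mf fM]] [mh [Mh hM]]; split; first exact: measurable_funM.
by exists (Mf * Mh) => y Dy; rewrite normrM ler_pM// ?fM ?hM.
Qed.

Lemma bounded_measurable_lin k f h : bounded_measurable f -> bounded_measurable h ->
  bounded_measurable (fun y => k * f y + h y).
Proof.
move=> bf [mh [Mh hM]].
have [mf [Mf fM]] := bounded_measurable_mul (bounded_measurable_cst k) bf.
split; first exact: measurable_funD.
exists (Mf + Mh) => y Dy; rewrite (le_trans (ler_normD _ _))// lerD//.
  exact: fM.
exact: hM.
Qed.

Lemma bounded_measurable_indic A : measurable A -> bounded_measurable (\1_A).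
Proof.
move=> mA; split; first exact: measurable_indic.
by exists 1 => y _; rewrite indicE; case: (_ \in _); rewrite ?normr1 ?normr0.
Qed.

(* The condition on limits suffices because step functions are uniformly dense. *)
Lemma bounded_measurable_ind (P : (T -> R) -> Prop) :
  (forall A, measurable A -> P (\1_A)) ->
  (forall k f h, P f -> P h -> P (fun y => k * f y + h y)) ->
  (forall f, bounded_measurable f ->
    (forall e : R, 0 < e -> exists2 h, P h & forall y, D y -> `|f y - h y| <= e) ->
    P f) ->
  forall f, bounded_measurable f -> P f.
Proof.
move=> P1 Plin Plim f bf; apply: (Plim _ bf) => e e0.
have [mf [M fM]] := bf.
(* [u] is the height of f above -M in units of [e]. Its integer part is the index of the slab of
   width [e] containing [f y], and the step function takes the lower end of that slab. *)
pose u y := (f y + M) / e.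
have u0 y : D y -> 0 <= u y.
  move=> Dy; rewrite divr_ge0 ?(ltW e0)//.
  by have := fM y Dy; rewrite ler_norml => /andP[]; rewrite -subr_ge0 opprK.
pose N := (Num.truncn (2 * M / e)).+1.
have uN y : D y -> (Num.truncn (u y) < N)%N.
  move=> Dy; rewrite ltnS; apply: le_truncn; rewrite /u ler_pM2r ?invr_gt0//.
  by have := fM y Dy; rewrite ler_norml => /andP[]; lra.
pose A k := D `&` f @^-1` `[k%:R * e - M, k.+1%:R * e - M[.
have mA k : measurable (A k) by exact: mf.
pose h y := \sum_(k < N) (k%:R * e - M) * \1_(A k) y.
exists h.
  rewrite /h.
  have P0 : P (fun=> 0) by have := P1 _ measurable0; rewrite indic0.
  elim: (index_enum _) => [|k s IH].
    by under eq_fun do rewrite big_nil.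
  by under eq_fun do rewrite big_cons; apply: Plin => //; exact: P1.
move=> y Dy; rewrite /h.
have uy0 := u0 y Dy.
have /andP[t1 t2] := truncn_itv uy0.
pose k0 := Ordinal (uN y Dy).
have Ak k : A k y <-> k = Num.truncn (u y).
  rewrite /A/= in_itv/= lerBlDr ltrBrDr -ler_pdivlMr// -ltr_pdivrMr// -/(u y).
  split=> [[_ kE]|->]; last by split=> //; rewrite t1 t2.
  exact/esym/truncn_def.
rewrite (bigD1 k0)//= big1 ?addr0; last first.
  move=> k kk0; rewrite indicE memNset ?mulr0// => /Ak E.
  by move/eqP: kk0; apply; exact/val_inj.
rewrite indicE mem_set ?mulr1; last exact/Ak.
have [_] := (Ak _).2 (erefl (Num.truncn (u y))).
rewrite /= in_itv/= => /andP[a1 a2].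
rewrite ger0_norm ?subr_ge0// lerBlDl.
by move: (ltW a2); rewrite -natr1 mulrDl mul1r; lra.
Qed.

End bounded_measurable.

Section bounded_integral.
Context d (T : measurableType d) (R : realType) (mu : probability T R) (D : set T).
Hypothesis mD : measurable D.
Implicit Types (f h : T -> R).

Lemma bounded_measurable_integrable f : bounded_measurable D f ->
  mu.-integrable D (EFin \o f).
Proof.
move=> [mf [M fM]]; apply: measurable_bounded_integrable => //.
  by rewrite (le_lt_trans (probability_le1 mu mD))// ltry.
by exists M; split; [exact: num_real|move=> N MN y Dy; exact: le_trans (fM y Dy) (ltW MN)].
Qed.

Lemma Rintegral_lin k f h : bounded_measurable D f -> bounded_measurable D h ->
  (\int[mu]_(y in D) (k * f y + h y) =
   k * \int[mu]_(y in D) f y + \int[mu]_(y in D) h y)%R.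
Proof.
move=> bf bh.
have bkf : bounded_measurable D (fun y => k * f y).
  exact/bounded_measurable_mul/bf/bounded_measurable_cst.
rewrite RintegralD//; [|exact: bounded_measurable_integrable..].
by rewrite RintegralZl//; exact: bounded_measurable_integrable.
Qed.

Lemma le_norm_Rintegral f (M : R) : 0 <= M -> bounded_measurable D f ->
  (forall y, D y -> `|f y| <= M) -> `|\int[mu]_(y in D) f y|%R <= M.
Proof.
move=> M0 bf fM.
have bnf : bounded_measurable D (fun y => `|f y|).
  have [mf _] := bf; split; first exact: measurableT_comp.
  by exists M => y Dy; rewrite normr_id fM.
rewrite (le_trans (le_normr_Rintegral mD (bounded_measurable_integrable bf)))//.
apply: (@le_trans _ _ (\int[mu]_(y in D) M)%R).
  apply: le_Rintegral => //; apply: bounded_measurable_integrable => //.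
  exact: bounded_measurable_cst.
rewrite Rintegral_cst// ler_piMr// -lee_fin fineK ?fin_num_measure//.
exact: probability_le1.
Qed.

Lemma Rintegral_approx f h (e : R) : 0 <= e ->
  bounded_measurable D f -> bounded_measurable D h ->
  (forall y, D y -> `|f y - h y| <= e) ->
  `|\int[mu]_(y in D) f y - \int[mu]_(y in D) h y|%R <= e.
Proof.
move=> e0 bf bh fh.
have E : (fun y => f y - h y) = (fun y => -1 * h y + f y).
  by apply/funext => y; rewrite mulN1r addrC.
have bfh : bounded_measurable D (fun y => f y - h y).
  by rewrite E; exact: bounded_measurable_lin.
rewrite (le_trans _ (le_norm_Rintegral e0 bfh fh))//.
by rewrite E Rintegral_lin// mulN1r addrC.
Qed.

End bounded_integral.

(** * Correlations and mixing *)

Section borel.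
Context {R : realType} {m : nat}.
Implicit Types (f : 'cV[R]_m -> R) (D : set 'cV[R]_m).

Lemma open_measurable_cV D : open D -> measurable (D : set (BorelcV R m)).
Proof. by move=> oD; exact: sub_sigma_algebra. Qed.

Lemma closed_measurable_cV D : closed D -> measurable (D : set (BorelcV R m)).
Proof.
move=> cD; rewrite -[D]setCK; apply: (@measurableC _ (BorelcV R m)).
by apply: open_measurable_cV; exact: closed_openC.
Qed.

Lemma compact_measurable_cV D : compact D -> measurable (D : set (BorelcV R m)).
Proof. by move=> cD; apply: closed_measurable_cV; exact: compact_closed. Qed.

Lemma continuous_measurable_cV n D (h : 'cV[R]_m -> 'cV[R]_n) :
  measurable (D : set (BorelcV R m)) -> {within D, continuous h} ->
  measurable_fun (D : set (BorelcV R m)) (h : BorelcV R m -> BorelcV R n).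
Proof.
move=> mD /continuousP ch; apply: (@measurability _ _ (BorelcV R m) (BorelcV R n) D h (@open 'cV[R]_n)) => //.
move=> _ [B oB <-]; have /open_subspaceP[V oV VE] := ch _ oB.
rewrite [X in measurable X](_ : _ = V `&` D); last by rewrite VE setIC.
by apply: measurableI => //; exact: open_measurable_cV.
Qed.

Lemma continuous_bounded_measurable D f : compact D -> continuous f ->
  bounded_measurable (D : set (BorelcV R m)) f.
Proof.
move=> cD cf; split.
  have mf : measurable_fun setT (f : BorelcV R m -> R).
    apply: (measurability _ (RGenOpens.measurableE R)).
    move=> _ [_ [a [b ->] <-]]; rewrite setTI; apply: open_measurable_cV.
    by move/continuousP : cf; apply; exact: interval_open.
  exact: (measurable_funS _ _ mf).
have : compact (f @` D).
  by apply: continuous_compact => //; exact: continuous_subspaceT.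
move=> /compact_bounded[M [Mr MK]]; exists (M + 1) => x Kx.
by apply: MK; [rewrite ltrDl|exists x].
Qed.

End borel.

Section correlations.
Context {R : realType} {m r : nat} {Lam : set 'cV[R]_m}
  {g : 'cV[R]_m -> 'cV[R]_m} {phi : R -> 'cV[R]_m -> 'cV[R]_m}
  {mu : probability (BorelcV R m) R}.
Hypotheses (cLam : compact Lam) (Cg : Cr r.+1 g) (flow : is_flow_on g Lam phi)
  (muLam : mu Lam = 1%E) (mixing : flow_mixing mu Lam phi).
Implicit Types (a f h : 'cV[R]_m -> R).

Let mLam : measurable (Lam : set (BorelcV R m)).
Proof. exact: compact_measurable_cV. Qed.

Let bm := @bounded_measurable _ (BorelcV R m) R Lam.

Lemma flow_measurable t :
  measurable_fun (Lam : set (BorelcV R m)) (phi t : BorelcV R m -> BorelcV R m).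
Proof. by apply: continuous_measurable_cV => //; exact: (flow_continuous cLam Cg flow). Qed.

Lemma bounded_measurable_flow h t : bm h -> bm (fun y => h (phi t y)).
Proof.
move=> [mh [M hM]]; split.
  apply: (@measurable_comp _ _ _ _ _ _ (Lam : set (BorelcV R m)) h) => //.
    by move=> _ [y Ly <-]; exact: (flow_in flow t Ly).
  exact: flow_measurable.
by exists M => y Ly; apply: hM; exact: (flow_in flow t Ly).
Qed.

Definition corr a h (t : R) : R := Rintegral mu Lam (fun y => a y * h (phi t y)).

Let bm_corr a h t : bm a -> bm h -> bm (fun y => a y * h (phi t y)).
Proof. by move=> ba bh; apply: bounded_measurable_mul => //; exact: bounded_measurable_flow. Qed.

Lemma corr_linl k a a' h t : bm a -> bm a' -> bm h ->
  corr (fun y => k * a y + a' y) h t = k * corr a h t + corr a' h t.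
Proof.
move=> ba ba' bh; rewrite /corr -Rintegral_lin//; [|exact: bm_corr..].
by congr Rintegral; apply/funext => y; rewrite mulrDl mulrA.
Qed.

Lemma corr_linr k a h h' t : bm a -> bm h -> bm h' ->
  corr a (fun y => k * h y + h' y) t = k * corr a h t + corr a h' t.
Proof.
move=> ba ba' bh; rewrite /corr -Rintegral_lin//; [|exact: bm_corr..].
by congr Rintegral; apply/funext => y; rewrite mulrDr mulrCA.
Qed.

Local Notation I f := (Rintegral mu Lam f).

(** An exchange of limits: the approximation is uniform in t, and the approximating limits tend to
    [l]. The constant [C] makes room for a bound on the factor that is not being approximated. *)
Lemma cvg_approx (F : R -> R) (l C : R) : 0 <= C ->
  (forall e, 0 < e -> exists G l', [/\ G t @[t --> +oo%R] --> l',
     (forall t : R, `|F t - G t| <= C * e) & `|l - l'| <= C * e]) ->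
  F t @[t --> +oo%R] --> l.
Proof.
move=> C0 H; apply/cvgrPdist_le => e e0.
(* Three errors have to add up to at most [e]; [C + 1] because [C] may be 0. *)
pose e' := e / (3 * (C + 1)).
have d0 : 0 < 3 * (C + 1) by rewrite mulr_gt0// ltr_wpDl.
have e'0 : 0 < e' by rewrite divr_gt0.
have Ce' : C * e' <= e / 3.
  rewrite /e' mulrA ler_pdivrMr// (_ : e / 3 * (3 * (C + 1)) = (C + 1) * e).
    by rewrite ler_wpM2r ?(ltW e0)// lerDl.
  by field.
have [G [l' [Gl' FG ll']]] := H _ e'0.
have e30 : 0 < e / 3 by rewrite divr_gt0.
near=> t.
have : `|l' - G t| <= e / 3 by near: t; exact: ((cvgrPdist_le _ _).1 Gl').
have := le_trans (FG t) Ce'.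
have := le_trans ll' Ce'.
rewrite !ler_norml; lra.
Unshelve. all: by end_near. Qed.

(** Indicators are integrated over [Lam], while mixing and invariance under the involution involve
    mu of arbitrary Borel sets; the full measure of [Lam] reconciles the two. *)
Lemma measure_setI_carrier (A : set (BorelcV R m)) : measurable A ->
  mu (A `&` Lam) = mu A.
Proof.
move=> mA; rewrite [RHS](measureDI _ mA mLam).
rewrite [X in _ = (X + _)%E](_ : _ = 0%E) ?add0e//.
apply: (@subset_measure0 _ _ _ mu _ (~` Lam)) => //.
- exact: measurableD.
- exact: measurableC.
- by apply: (etrans (probability_setC mu mLam)); rewrite [X in (_ - X)%E]muLam subee.
Qed.

Lemma corr_mixing_indic (A B : set (BorelcV R m)) : measurable A -> measurable B ->
  corr (\1_A) (\1_B) t @[t --> +oo%R] --> I (\1_A) * I (\1_B).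
Proof.
move=> mA mB.
have IE (C : set (BorelcV R m)) : measurable C -> I (\1_C) = fine (mu C).
  by move=> mC; rewrite /Rintegral integral_indic//; congr fine; exact: measure_setI_carrier.
have E t : corr (\1_A) (\1_B) t = fine (mu (A `&` (Lam `&` phi t @^-1` B))).
  have mAB : measurable (A `&` (Lam `&` phi t @^-1` B) : set (BorelcV R m)).
    by apply: measurableI => //; exact: flow_measurable.
  rewrite -IE// /corr; apply: eq_Rintegral => y; rewrite inE => Ly.
  rewrite !indicE -natrM mulnb; congr (_ _)%:R; apply/andP/idP.
    by move=> [/set_mem Ay /set_mem By]; apply/mem_set.
  by move=> /set_mem[Ay [_ By]]; split; exact/mem_set.
rewrite !IE// (_ : corr _ _ = fun t => fine (mu (A `&` (Lam `&` phi t @^-1` B)))).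
  rewrite -fineM ?fin_num_measure//; apply: fine_cvg.
  rewrite fineK ?fin_numM ?fin_num_measure//; exact: mixing.
by apply/funext => t; exact: E.
Qed.

(** Two nested approximations: h varies while a is an indicator, then a varies with h fixed. A
    sup-norm error in one factor changes the correlation by an amount uniform in t. The induction
    predicates also carry boundedness, which linearity of [corr] requires. *)
Lemma corr_mixing a h : bm a -> bm h -> corr a h t @[t --> +oo%R] --> I a * I h.
Proof.
move=> ba bh.
have half (A : set (BorelcV R m)) f : measurable A -> bm f ->
    bm f /\ corr (\1_A) f t @[t --> +oo%R] --> I (\1_A) * I f.
  move=> mA; have b1 : bm (\1_A) by exact: bounded_measurable_indic.
  move: f; apply: (bounded_measurable_ind mLam (P := fun f => bm f /\ _)).
  - by move=> B mB; split; [exact: bounded_measurable_indic|exact: corr_mixing_indic].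
  - move=> k f f' [bf cf] [bf' cf']; split; first exact: bounded_measurable_lin.
    rewrite Rintegral_lin// mulrDr mulrCA.
    rewrite (_ : corr _ _ = fun t => k * corr (\1_A) f t + corr (\1_A) f' t).
      by apply: cvgD => //; apply: cvgMr.
    by apply/funext => t; exact: corr_linr.
  - move=> f bf H; split => //; apply: (@cvg_approx _ _ 1) => // e e0.
    have [f' [bf' cf'] ff'] := H _ e0.
    have le1 y : `|\1_A y : R| <= 1.
      by rewrite indicE; case: (_ \in _); rewrite ?normr1 ?normr0.
    exists (corr (\1_A) f'), (I (\1_A) * I f'); split=> // [t|]; rewrite mul1r.
      apply: Rintegral_approx => //; [exact: ltW|exact: bm_corr..|].
      move=> y Ly; rewrite -mulrBr normrM -[leRHS]mul1r ler_pM//.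
      exact/ff'/(flow_in flow).
    rewrite -mulrBr normrM -[leRHS]mul1r ler_pM//.
      exact: (le_norm_Rintegral mu mLam ler01 b1 (fun y _ => le1 y)).
    by apply: Rintegral_approx => //; exact: ltW.
have [_ [M hM]] := bh.
pose C := Num.max 0 M.
have hC y : Lam y -> `|h y| <= C by move=> Ly; rewrite le_max hM// orbT.
have C0 : 0 <= C by rewrite le_max lexx.
suff : bm a /\ corr a h t @[t --> +oo%R] --> I a * I h by case.
move: a ba; apply: (bounded_measurable_ind mLam (P := fun f => bm f /\ _)).
- move=> A mA; split; first exact: bounded_measurable_indic.
  by have [] := half _ _ mA bh.
- move=> k f f' [bf cf] [bf' cf']; split; first exact: bounded_measurable_lin.
  rewrite Rintegral_lin// mulrDl -mulrA.
  rewrite (_ : corr _ _ = fun t => k * corr f h t + corr f' h t).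
    by apply: cvgD => //; apply: cvgMr.
  by apply/funext => t; exact: corr_linl.
- move=> f bf H; split => //; apply: (@cvg_approx _ _ C) => // e e0.
  have [f' [bf' cf'] ff'] := H _ e0.
  exists (corr f' h), (I f' * I h); split=> // [t|].
    apply: Rintegral_approx => //; [by rewrite mulr_ge0// ltW|exact: bm_corr..|].
    move=> y Ly; rewrite -mulrBl normrM mulrC ler_pM//; last exact: ff'.
    exact/hC/(flow_in flow).
  rewrite -mulrBl normrM mulrC ler_pM//.
    exact: le_norm_Rintegral.
  by apply: Rintegral_approx => //; exact: ltW.
Qed.

End correlations.

(** * Time integrals of correlations *)

Section correlation_integrals.
Context {R : realType} {m r : nat} {Lam : set 'cV[R]_m}
  {g : 'cV[R]_m -> 'cV[R]_m} {phi : R -> 'cV[R]_m -> 'cV[R]_m}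
  {mu : probability (BorelcV R m) R}.
Hypotheses (cLam : compact Lam) (Cg : Cr r.+1 g) (flow : is_flow_on g Lam phi)
  (muLam : mu Lam = 1%E) (mixing : flow_mixing mu Lam phi).
Implicit Types (a h F L : 'cV[R]_m -> R).

Let mLam : measurable (Lam : set (BorelcV R m)).
Proof. exact: compact_measurable_cV. Qed.

Let bm := @bounded_measurable _ (BorelcV R m) R Lam.

Local Notation I f := (Rintegral mu Lam f).
Local Notation corr := (@corr R m Lam phi mu).

Let bm_corr a h t : bm a -> bm h -> bm (fun y => a y * h (phi t y)).
Proof.
move=> ba bh; apply: bounded_measurable_mul => //.
exact: (bounded_measurable_flow cLam Cg flow).
Qed.

Lemma flow_continuous_time y : Lam y -> continuous (phi ^~ y).
Proof.
move=> Ly t; apply/continuous_colP => k.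
by apply/differentiable_continuous/derivable1_diffP; have [] := flow_derive flow t k Ly.
Qed.

(** Dominated convergence: trajectories are continuous in time and the integrand is bounded by Ma Mh
    for all t. Continuity then makes correlations integrable over [0, T]. *)
Lemma corr_continuous a h : bm a -> continuous h -> continuous (corr a h).
Proof.
move=> ba ch t.
have bh : bm h by exact: continuous_bounded_measurable.
have [[_ [Ma aM]] [_ [Mh hM]]] := (ba, bh).
have := @continuity_under_integral R _ (BorelcV R m) mu
  (fun t y => a y * h (phi t y)) Lam mLam (t - 1) (t + 1) _ _ (fun=> Ma * Mh) _ _ t.
apply.
- by move=> s _; apply: bounded_measurable_integrable => //; exact: bm_corr.
- apply: nearW => y Ly s _; apply: cvgM; first exact: cvg_cst.
  exact: (continuous_comp (flow_continuous_time Ly (x := s)) (ch _)).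
- apply: bounded_measurable_integrable => //; exact: bounded_measurable_cst.
- move=> s _; apply: nearW => y Ly; rewrite normrM ler_pM//; first exact: aM.
  by apply: hM; exact: (flow_in flow).
- by rewrite inE/= in_itv/=; apply/andP; split; lra.
Qed.

(** The Lie derivative of F along g, expressed through trajectories, so that total differentiability
    of F does not enter. *)
Definition flow_derivative F L := forall y, Lam y -> forall t : R,
  is_derive t 1 (fun s => F (phi s y)) (L (phi t y)).

(** Differentiation under the integral with a constant dominating function. The derivative being
    again a correlation is what lets the time integral telescope. *)
Lemma corr_derive a F L (t : R) : bm a -> continuous F -> continuous L ->
  flow_derivative F L -> is_derive t 1 (corr a F) (corr a L t).
Proof.
move=> ba cF cL FL.
have bF : bm F by exact: continuous_bounded_measurable.
have bL : bm L by exact: continuous_bounded_measurable.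
have [[_ [Ma aM]] [_ [ML LM]]] := (ba, bL).
have d1 (s : R) y : Lam y -> is_derive s 1 (fun s : R => a y * F (phi s y)) (a y * L (phi s y)).
  by move=> Ly; have := FL y Ly s => dF; apply: is_derive_eq.
pose f (s : R) y := a y * F (phi s y).
have d1E (s : R) y : Lam y -> partial1of2 f s y = a y * L (phi s y).
  by move=> Ly; rewrite partial1of2E; have [_ ->] := d1 s y Ly.
have It : (`]t - 1, t + 1[%classic : set R) t.
  by rewrite /= in_itv/=; apply/andP; split; lra.
have if_ s : (`]t - 1, t + 1[%classic : set R) s -> mu.-integrable Lam (EFin \o f s).
  by move=> _; apply: bounded_measurable_integrable => //; exact: bm_corr.
have df s y : (`]t - 1, t + 1[%classic : set R) s -> Lam y -> derivable (f ^~ y) s 1.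
  by move=> _ Ly; have [] := d1 s y Ly.
have G0 (y : BorelcV R m) : 0 <= `|Ma * ML| by [].
have iG : mu.-integrable Lam (EFin \o (fun y : BorelcV R m => `|Ma * ML|)).
  by apply: bounded_measurable_integrable => //; exact: bounded_measurable_cst.
have Gub s y : (`]t - 1, t + 1[%classic : set R) s -> Lam y ->
    `|partial1of2 f s y| <= `|Ma * ML|.
  move=> _ Ly; rewrite d1E// (le_trans _ (ler_norm _))// normrM ler_pM//.
    exact: aM.
  by apply: LM; exact: (flow_in flow).
split; first exact: (derivable_under_integral mLam It if_ df G0 iG Gub).
rewrite -derive1E (differentiation_under_integral mLam It if_ df G0 iG Gub).
by apply: eq_Rintegral => y /set_mem Ly; exact: d1E.
Qed.

Lemma Rintegral_corr a F L (T : R) : 0 < T -> bm a -> continuous F ->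
  continuous L -> flow_derivative F L ->
  Rintegral lebesgue_measure `[0, T]%classic (corr a L) = corr a F T - corr a F 0.
Proof.
move=> T0 ba cF cL FL.
have d := fun t => corr_derive t ba cF cL FL.
have cc : continuous (corr a F).
  by move=> t; apply/differentiable_continuous/derivable1_diffP; have [] := d t.
rewrite /Rintegral (continuous_FTC2 T0 (F := corr a F))//.
- by apply: continuous_subspaceT; exact: corr_continuous.
- split; first by move=> t _; have [] := d t.
    exact/cvg_at_right_filter/cc.
  exact/cvg_at_left_filter/cc.
- by move=> t _; rewrite derive1E; have [_ ->] := d t.
Qed.

(* Green-Kubo integral against a flow derivative: the time integral telescopes
   and mixing kills the boundary term at infinity. *)
Lemma cvg_Rintegral_corr a F L : bm a -> continuous F -> continuous L ->
  flow_derivative F L -> I a = 0 ->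
  Rintegral lebesgue_measure `[0, T]%classic (corr a L) @[T --> +oo%R] -->
    - I (fun y => a y * F y).
Proof.
move=> ba cF cL FL Ia.
have bF : bm F by exact: continuous_bounded_measurable.
have c0 : corr a F 0 = I (fun y => a y * F y).
  by apply: eq_Rintegral => y /set_mem Ly; rewrite (flow0 flow).
have : corr a F t - corr a F 0 @[t --> +oo%R] --> I a * I F - corr a F 0.
  apply: cvgB; last exact: cvg_cst.
  exact: (corr_mixing cLam Cg flow muLam mixing).
rewrite Ia mul0r sub0r c0; apply: cvg_trans; apply: near_eq_cvg.
near=> T; rewrite (@Rintegral_corr a F L)// c0//.
Unshelve. all: by end_near. Qed.

Let Rintegral_corr_sum k a h a' h' T : bm a -> continuous h -> bm a' -> continuous h' ->
  Rintegral lebesgue_measure `[0, T]%classic (fun t => k * corr a h t + corr a' h' t) =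
  k * Rintegral lebesgue_measure `[0, T]%classic (corr a h) +
  Rintegral lebesgue_measure `[0, T]%classic (corr a' h').
Proof.
move=> ba ch ba' ch'.
have icorr b f : bm b -> continuous f ->
    lebesgue_measure.-integrable `[0, T]%classic (EFin \o corr b f).
  move=> bb cf; apply: continuous_compact_integrable; first exact: segment_compact.
  by apply: continuous_subspaceT; exact: corr_continuous.
have ikcorr : lebesgue_measure.-integrable `[0, T]%classic (EFin \o (fun t => k * corr a h t)).
  apply: continuous_compact_integrable; first exact: segment_compact.
  apply: continuous_subspaceT => t; apply: cvgM; first exact: cvg_cst.
  exact: corr_continuous.
rewrite RintegralD//; last exact: icorr.
by rewrite RintegralZl//; exact: icorr.
Qed.

Lemma Rintegral_corr_linr k a h h' T : bm a -> continuous h -> continuous h' ->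
  Rintegral lebesgue_measure `[0, T]%classic (corr a (fun y => k * h y + h' y)) =
  k * Rintegral lebesgue_measure `[0, T]%classic (corr a h) +
  Rintegral lebesgue_measure `[0, T]%classic (corr a h').
Proof.
move=> ba ch ch'; rewrite -Rintegral_corr_sum//; congr Rintegral.
apply/funext => t; apply: (corr_linr cLam Cg flow) => //.
  exact: continuous_bounded_measurable.
exact: continuous_bounded_measurable.
Qed.

Lemma Rintegral_corr_linl k a a' h T : bm a -> bm a' -> continuous h ->
  Rintegral lebesgue_measure `[0, T]%classic (corr (fun y => k * a y + a' y) h) =
  k * Rintegral lebesgue_measure `[0, T]%classic (corr a h) +
  Rintegral lebesgue_measure `[0, T]%classic (corr a' h).
Proof.
move=> ba ba' ch; rewrite -Rintegral_corr_sum//; congr Rintegral.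
apply/funext => t; apply: (corr_linl cLam Cg flow) => //.
exact: continuous_bounded_measurable.
Qed.

End correlation_integrals.

(** * Absence of atoms *)

(** Splitting off a root lowers the size. The list serves to turn a polynomial relation holding
    almost everywhere into finite support. *)
Lemma poly_roots_seq (K : fieldType) (p : {poly K}) : p != 0 ->
  exists l : seq K, forall x, root p x -> x \in l.
Proof.
elim: (size p) {-2}p (leqnn (size p)) => {p} [p|n IH p sp p0].
  by rewrite leqn0 size_poly_eq0 => ->.
have [[x px]|nr] := pselect (exists x, root p x); last first.
  by exists [::] => x px; exfalso; apply: nr; exists x.
have /factor_theorem[q pE] := px.
have q0 : q != 0 by apply: contraNneq p0 => q0; rewrite pE q0 mul0r.
have [|l ql] := IH q _ q0.
  by move: sp; rewrite pE size_Mmonic ?monicXsubC// size_XsubC addn2.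
exists (x :: l) => y; rewrite pE rootM root_XsubC in_cons => /orP[/ql->|->//].
by rewrite orbT.
Qed.

Section negligible_finite.
Context d (T : measurableType d) (R : realType) (mu : {measure set T -> \bar R}).

Lemma negligible_exists (I : finType) (N : I -> set T) :
  (forall i, mu.-negligible (N i)) -> mu.-negligible [set y | exists i, N i y].
Proof.
move=> negN.
suff H (s : seq I) : mu.-negligible [set y | exists2 i, i \in s & N i y].
  apply: negligibleS (H (enum I)) => y [i Ni]; exists i => //.
  by rewrite mem_enum.
elim: s => [|i s IH]; first by apply: negligibleS (negligible_set0 mu) => y [].
apply: negligibleS (negligibleU (negN i) IH) => y [j].
by rewrite in_cons => /predU1P[->|js] Ny; [left|right; exists j].
Qed.

End negligible_finite.

Section nonatomic.
Context {R : realType} {m : nat} {Lam : set 'cV[R]_m}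
  {phi : R -> 'cV[R]_m -> 'cV[R]_m} {mu : probability (BorelcV R m) R}.
Hypotheses (mixing : flow_mixing mu Lam phi) (ndirac : ~ is_dirac mu)
  (cLam : compact Lam) (muLam : mu Lam = 1%E).

Lemma measurable_point (y : 'cV[R]_m) : measurable ([set y] : set (BorelcV R m)).
Proof. by apply: compact_measurable_cV; exact: compact_set1. Qed.

(* The sets {y} n phi_t^-1 {y} have measure 0 or mu {y}, and these measures
   converge to (mu {y})^2: so mu {y} is 0 or 1. *)
Lemma mixing_nonatomic (y : 'cV[R]_m) : mu ([set y] : set (BorelcV R m)) = 0%E.
Proof.
have my := measurable_point y.
set p := mu [set y]; apply: contrapT => p0.
have pfin : p \is a fin_num by exact: fin_num_measure.
have p_gt0 : (0 < p)%E by rewrite lt_neqAle measure_ge0 andbT eq_sym; exact/eqP.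
have pE t : mu ([set y] `&` (Lam `&` (phi t @^-1` [set y]))) = p \/
            mu ([set y] `&` (Lam `&` (phi t @^-1` [set y]))) = 0%E.
  have [yt|yt] := pselect (Lam y /\ phi t y = y); [left|right].
    by congr (mu _); apply/seteqP; split=> [z []//|z ->].
  rewrite [X in mu X](_ : _ = set0) ?measure0//.
  by rewrite -subset0 => z [-> [Ly /= yty]]; apply: yt.
have pp : p = (p * p)%E.
  have := mixing my my => cvp.
  have pp0 : (0 < p * p)%E by rewrite mule_gt0.
  have near_p : \forall t \near +oo%R, mu ([set y] `&` (Lam `&` (phi t @^-1` [set y]))) = p.
    have pos : \forall t \near +oo%R,
        (0 < mu ([set y] `&` (Lam `&` (phi t @^-1` [set y]))))%E.
      exact: (cvp _ (open_ereal_gt' pp0)).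
    near=> t; have : (0 < mu ([set y] `&` (Lam `&` (phi t @^-1` [set y]))))%E by near: t.
    by have [->//|->] := pE t; rewrite ltxx.
  have cp : mu ([set y] `&` (Lam `&` (phi t @^-1` [set y]))) @[t --> +oo%R] --> p.
    by apply: cvg_near_cst.
  by have := cvg_unique _ cp cvp; apply.
have p1 : p = 1%E.
  move: pp p_gt0; rewrite -(fineK pfin) -EFinM lte_fin => -[q2] q0.
  congr EFin; apply: (mulfI (lt0r_neq0 q0)).
  by rewrite mulr1 -q2.
apply: ndirac; exists y => A mA; rewrite diracE.
case: (boolP (y \in A)) => [/set_mem Ay|/negP yA] /=.
  apply/eqP; rewrite eq_le probability_le1//= -[leLHS]p1.
  by apply: le_measure; rewrite ?inE// => z ->.
apply: (@subset_measure0 _ _ _ mu _ (~` [set y])) => //; first exact: measurableC.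
  by move=> z Az zy; apply: yA; rewrite -zy; exact/mem_set.
by apply: (etrans (probability_setC mu my)); rewrite [X in (_ - X)%E]p1 subee.
Unshelve. all: by end_near. Qed.

Lemma negligible_seq (s : seq 'cV[R]_m) :
  mu.-negligible ([set y | y \in s] : set (BorelcV R m)).
Proof.
elim: s => [|x s IH]; first by apply: negligibleS (negligible_set0 mu) => y.
have neg1 : mu.-negligible ([set x] : set (BorelcV R m)).
  exists [set x]; split=> //; [exact: measurable_point|exact: mixing_nonatomic].
apply: negligibleS (negligibleU neg1 IH) => y /=.
by rewrite in_cons => /predU1P[->|ys]; [left|right].
Qed.

(** The law of F is carried by a finite set. Negligibility, rather than measure zero, spares a
    measurability assumption on F. *)
Definition finitely_supported (F : 'cV[R]_m -> R) :=
  exists l : seq R, mu.-negligible (Lam `&` [set y | F y \notin l] : set (BorelcV R m)).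

(* If the symmetric functions y_i + y'_i and y_i y'_i were all finitely valued
   almost everywhere, then so would be y, and mu would have an atom. *)
Lemma exists_not_finitely_supported (S : 'cV[R]_m -> 'cV[R]_m) : exists i,
  ~ finitely_supported (fun y => y i 0 + S y i 0) \/
  ~ finitely_supported (fun y => y i 0 * S y i 0).
Proof.
apply: contrapT => H.
have fin i : finitely_supported (fun y => y i 0).
  have [l1 n1] : finitely_supported (fun y => y i 0 + S y i 0).
    by apply: contrapT => n1; apply: H; exists i; left.
  have [l2 n2] : finitely_supported (fun y => y i 0 * S y i 0).
    by apply: contrapT => n2; apply: H; exists i; right.
  (* [y i 0] is a root of this polynomial when a and b are the sum and the product of [y i 0] and
     [S y i 0]; finitely many pairs (a, b) leave finitely many roots. *)
  pose q a b : {poly R} := 'X^2 - a *: 'X + b%:P.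
  have q0 a b : q a b != 0.
    apply/eqP => /polyP/(_ 2%N); rewrite !coefE/= mulr0 subr0 addr0 => /eqP.
    by rewrite oner_eq0.
  have /choice[Z ZP] : forall ab : R * R, exists l : seq R,
      forall x, root (q ab.1 ab.2) x -> x \in l.
    by move=> ab; apply: poly_roots_seq.
  exists (flatten [seq Z (a, b) | a <- l1, b <- l2]).
  apply: negligibleS (negligibleU n1 n2) => y [Ly /= yl].
  have [s1|s1] := boolP (y i 0 + S y i 0 \in l1); last by left.
  have [s2|s2] := boolP (y i 0 * S y i 0 \in l2); last by right.
  exfalso; move/negP: yl; apply; apply/flattenP.
  exists (Z (y i 0 + S y i 0, y i 0 * S y i 0)).
    by apply/allpairsP; exists (y i 0 + S y i 0, y i 0 * S y i 0).
  by apply: ZP; rewrite /root /q !hornerE/=; apply/eqP; ring.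
have /choice[l lP] := fin.
(* [c] enumerates a finite grid containing almost every point of [Lam]. Finite sets are null, so
   [Lam] would be null. *)
pose c (f : {ffun 'I_m -> seq_sub (flatten [seq l i | i : 'I_m])}) : 'cV[R]_m :=
  \col_i val (f i).
have : mu Lam = 0%E.
  apply: measure_negligible; first exact: compact_measurable_cV.
  apply: negligibleS (negligibleU (negligible_exists lP)
    (negligible_seq [seq c f | f : {ffun 'I_m -> _}])) => y Ly.
  have [ex|nex] := pselect (exists i, y i 0 \notin l i).
    by left; have [i yi] := ex; exists i.
  right => /=.
  have yl i : y i 0 \in flatten [seq l i | i : 'I_m].
    apply/flattenP; exists (l i); first by apply/mapP; exists i; rewrite ?mem_enum.
    by apply: contrapT => /negP yi; apply: nex; exists i.
  apply/mapP; exists [ffun i => SeqSub (yl i)]; first by rewrite mem_enum.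
  by apply/colP => i; rewrite !mxE ffunE.
by rewrite muLam => /eqP; rewrite onee_eq0.
Qed.

End nonatomic.

(** * Even and odd observables *)

Section observables.
Context {R : realType} {m r : nat} {Lam : set 'cV[R]_m}
  {g : 'cV[R]_m -> 'cV[R]_m} {phi : R -> 'cV[R]_m -> 'cV[R]_m}
  {mu : probability (BorelcV R m) R} {Rm : 'M[R]_m}.
Hypotheses (cLam : compact Lam) (Cg : Cr r.+1 g) (flow : is_flow_on g Lam phi)
  (muLam : mu Lam = 1%E) (mixing : flow_mixing mu Lam phi)
  (RmK : Rm *m Rm = 1%:M) (RLam : (fun y => Rm *m y) @` Lam = Lam)
  (Rmu : forall A : set (BorelcV R m), measurable A ->
     mu ((fun y : 'cV[R]_m => Rm *m y) @^-1` A) = mu A)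
  (Rg : forall y, Lam y -> g (Rm *m y) = - (Rm *m g y))
  (ndirac : ~ is_dirac mu).
Implicit Types (a c F L : 'cV[R]_m -> R).

Let mLam : measurable (Lam : set (BorelcV R m)).
Proof. exact: compact_measurable_cV. Qed.

Local Notation bm := (@bounded_measurable _ (BorelcV R m) R Lam).
Local Notation I f := (Rintegral mu Lam f).
Local Notation corr := (@corr R m Lam phi mu).

Lemma continuous_mulmx : continuous (fun y : 'cV[R]_m => Rm *m y).
Proof. by move=> y; apply/continuous_colP => k; exact: (Cr1_continuous (@Cr1_mulmx _ _ 0 _ Rm k)). Qed.

Lemma involution_in y : Lam y -> Lam (Rm *m y).
Proof. by move=> Ly; rewrite -RLam; exists y. Qed.

Lemma involutionK (y : 'cV[R]_m) : Rm *m (Rm *m y) = y.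
Proof. by rewrite mulmxA RmK mul1mx. Qed.

(** Even and odd observables are the coordinates of v^+ and v^-. The mean-zero condition appears
    only here, since for odd observables it follows from [odd_observable_mean]. *)
Definition even_observable a :=
  [/\ Cr1 r.+1 a, (forall y, Lam y -> a (Rm *m y) = a y) & I a = 0].

Definition odd_observable c :=
  Cr1 r.+1 c /\ forall y, Lam y -> c (Rm *m y) = - c y.

Lemma Cr1_bounded_measurable a : Cr1 r.+1 a -> bm a.
Proof. by move=> Ca; apply: continuous_bounded_measurable => //; exact: Cr1_continuous Ca. Qed.

(** Invariance of mu is the case of indicators; linearity and uniform approximation extend it to
    bounded measurable functions. *)
Lemma Rintegral_involution a : continuous a -> I (fun y => a (Rm *m y)) = I a.
Proof.
move=> ca; have ba : bm a by exact: continuous_bounded_measurable.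
suff : bm (fun y => a (Rm *m y)) /\ I (fun y => a (Rm *m y)) = I a by case.
have mR : measurable_fun setT (fun y : BorelcV R m => (Rm *m y : BorelcV R m)).
  apply: continuous_measurable_cV; first exact: measurableT.
  by apply: continuous_subspaceT; exact: continuous_mulmx.
have bR f : bm f -> bm (fun y => f (Rm *m y)).
  move=> [mf [M fM]]; split.
    apply: (@measurable_comp _ _ _ _ _ _ (Lam : set (BorelcV R m)) f) => //.
      by move=> _ [y Ly <-]; exact: involution_in.
    exact: measurable_funS mR.
  by exists M => y Ly; apply: fM; exact: involution_in.
split; first exact: bR.
suff : bm a /\ I (fun y => a (Rm *m y)) = I a by case.
move: a ba {ca}; apply: (bounded_measurable_ind mLam (P := fun f => bm f /\ _)).
- move=> A mA; split; first exact: bounded_measurable_indic.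
  have mRA : measurable ((fun y : BorelcV R m => (Rm *m y : BorelcV R m)) @^-1` A).
    by rewrite -[X in measurable X]setTI; exact: mR.
  have IE (C : set (BorelcV R m)) : measurable C -> I (\1_C) = fine (mu C).
    move=> mC; rewrite /Rintegral integral_indic//; congr fine.
    exact: measure_setI_carrier.
  by rewrite [RHS]IE// -Rmu// -IE.
- move=> k f h [bf ef] [bh eh]; split; first exact: bounded_measurable_lin.
  rewrite (Rintegral_lin mu mLam k bf bh) -ef -eh.
  by rewrite -Rintegral_lin//; exact: bR.
- move=> f bf H; split=> //; apply/eqP; rewrite -subr_eq0 -normr_le0.
  apply/ler_addgt0Pr => e e0; rewrite add0r.
  have [h [bh eh] fh] := H (e / 2) (divr_gt0 e0 (ltr0n _ 2)).
  have e20 : 0 <= e / 2 by rewrite divr_ge0// ltW.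
  have h1 := Rintegral_approx mu mLam e20 bf bh fh.
  have h2 := Rintegral_approx mu mLam e20 (bR _ bf) (bR _ bh)
    (fun y Ly => fh _ (involution_in Ly)).
  move: h1 h2; rewrite eh !ler_norml; lra.
Qed.

Lemma odd_observable_mean c : odd_observable c -> I c = 0.
Proof.
move=> [Cc oc]; have cc := Cr1_continuous Cc.
have bc := Cr1_bounded_measurable Cc.
have E : I c = - I c.
  rewrite -{1}(Rintegral_involution cc) -mulN1r.
  rewrite -RintegralZl//; last exact: bounded_measurable_integrable.
  by apply: eq_Rintegral => y /set_mem Ly; rewrite oc// mulN1r.
by move: E; lra.
Qed.

Lemma even_observable0 : even_observable (fun=> 0).
Proof.
split=> //; first exact: Cr1_cst.
by rewrite Rintegral_cst// mul0r.
Qed.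

Lemma even_observable_lin k a a' : even_observable a -> even_observable a' ->
  even_observable (fun y => k * a y + a' y).
Proof.
move=> [Ca ea Ia] [Ca' ea' Ia']; split.
- by apply: Cr1D => //; exact: Cr1Z.
- by move=> y Ly; rewrite ea// ea'.
- by rewrite Rintegral_lin// ?Ia ?Ia' ?mulr0 ?addr0//; exact: Cr1_bounded_measurable.
Qed.

Lemma even_observable_sum (J : Type) (s : seq J) (k : J -> R)
    (a : J -> 'cV[R]_m -> R) : (forall j, even_observable (a j)) ->
  even_observable (fun y => \sum_(j <- s) k j * a j y).
Proof.
move=> ea; elim: s => [|j s IH].
  by under eq_fun do rewrite big_nil; exact: even_observable0.
by under eq_fun do rewrite big_cons; exact: even_observable_lin.
Qed.

Lemma odd_observable0 : odd_observable (fun=> 0).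
Proof. by split=> [|y _]; [exact: Cr1_cst|rewrite oppr0]. Qed.

Lemma odd_observable_lin k c c' : odd_observable c -> odd_observable c' ->
  odd_observable (fun y => k * c y + c' y).
Proof.
move=> [Cc oc] [Cc' oc']; split; first by apply: Cr1D => //; exact: Cr1Z.
by move=> y Ly; rewrite oc// oc'// mulrN opprD.
Qed.

Lemma odd_observable_sum (J : Type) (s : seq J) (k : J -> R)
    (c : J -> 'cV[R]_m -> R) : (forall j, odd_observable (c j)) ->
  odd_observable (fun y => \sum_(j <- s) k j * c j y).
Proof.
move=> oc; elim: s => [|j s IH].
  by under eq_fun do rewrite big_nil; exact: odd_observable0.
by under eq_fun do rewrite big_cons; exact: odd_observable_lin.
Qed.

(** * Bilinearity of the Green-Kubo pairing *)

Section green_kubo.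

Definition corr_integral a c (T : R) :=
  Rintegral lebesgue_measure `[0, T]%classic (corr a c).

Definition green_kubo a c : R := 2 * lim (corr_integral a c T @[T --> +oo%R]).

Hypothesis cvg_corr : forall a c, even_observable a -> odd_observable c ->
  cvg (corr_integral a c T @[T --> +oo%R]).

(** [lim] respects linear combinations only where the limits exist, which is what [cvg_corr]
    supplies. *)
Lemma green_kubo_linl k a a' c :
  even_observable a -> even_observable a' -> odd_observable c ->
  green_kubo (fun y => k * a y + a' y) c = k * green_kubo a c + green_kubo a' c.
Proof.
move=> ea ea' oc.
have [[[Ca _ _] [Ca' _ _]] [Cc _]] := (ea, ea', oc).
rewrite /green_kubo mulrCA -mulrDr; congr (_ * _).
apply/cvg_lim => //.
rewrite (_ : corr_integral _ _ = fun T => k * corr_integral a c T + corr_integral a' c T).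
  apply: cvgD; last exact: cvg_corr.
  by apply: cvgMr; exact: cvg_corr.
apply/funext => T; apply: (Rintegral_corr_linl cLam Cg flow).
- exact: Cr1_bounded_measurable.
- exact: Cr1_bounded_measurable.
- exact: Cr1_continuous Cc.
Qed.

Lemma green_kubo_linr k a c c' :
  even_observable a -> odd_observable c -> odd_observable c' ->
  green_kubo a (fun y => k * c y + c' y) = k * green_kubo a c + green_kubo a c'.
Proof.
move=> ea oc oc'.
have [[[Ca _ _] [Cc _]] [Cc' _]] := (ea, oc, oc').
rewrite /green_kubo mulrCA -mulrDr; congr (_ * _).
apply/cvg_lim => //.
rewrite (_ : corr_integral _ _ = fun T => k * corr_integral a c T + corr_integral a c' T).
  apply: cvgD; last exact: cvg_corr.
  by apply: cvgMr; exact: cvg_corr.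
apply/funext => T; apply: (Rintegral_corr_linr cLam Cg flow).
- exact: Cr1_bounded_measurable.
- exact: Cr1_continuous Cc.
- exact: Cr1_continuous Cc'.
Qed.

Lemma green_kubo_suml (J : Type) (s : seq J) (k : J -> R)
    (a : J -> 'cV[R]_m -> R) c :
  (forall j, even_observable (a j)) -> odd_observable c ->
  green_kubo (fun y => \sum_(j <- s) k j * a j y) c =
  \sum_(j <- s) k j * green_kubo (a j) c.
Proof.
move=> ea oc; elim: s => [|j s IH].
  rewrite big_nil; under eq_fun do rewrite big_nil.
  (* Linearity at the zero observable with k = -1 reads x = - x + x, so the pairing x vanishes
     there. *)
  have E := green_kubo_linl (-1) even_observable0 even_observable0 oc.
  have Z : (fun _ : 'cV[R]_m => -1 * 0 + 0) = (fun=> 0 : R).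
    by apply/funext => y; rewrite mulr0 addr0.
  by rewrite Z in E; move: E; set x := green_kubo _ _ => E; lra.
have -> : (fun y => \sum_(j <- j :: s) k j * a j y) =
    fun y => k j * a j y + \sum_(j <- s) k j * a j y.
  by apply/funext => y; rewrite big_cons.
by rewrite (green_kubo_linl (k j) (ea j) (even_observable_sum s k ea) oc) IH big_cons.
Qed.

Lemma green_kubo_sumr (J : Type) (s : seq J) (k : J -> R)
    a (c : J -> 'cV[R]_m -> R) :
  even_observable a -> (forall j, odd_observable (c j)) ->
  green_kubo a (fun y => \sum_(j <- s) k j * c j y) =
  \sum_(j <- s) k j * green_kubo a (c j).
Proof.
move=> ea oc; elim: s => [|j s IH].
  rewrite big_nil; under eq_fun do rewrite big_nil.
  have E := green_kubo_linr (-1) ea odd_observable0 odd_observable0.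
  have Z : (fun _ : 'cV[R]_m => -1 * 0 + 0) = (fun=> 0 : R).
    by apply/funext => y; rewrite mulr0 addr0.
  by rewrite Z in E; move: E; set x := green_kubo _ _ => E; lra.
have -> : (fun y => \sum_(j <- j :: s) k j * c j y) =
    fun y => k j * c j y + \sum_(j <- s) k j * c j y.
  by apply/funext => y; rewrite big_cons.
by rewrite (green_kubo_linr (k j) ea (oc j) (odd_observable_sum s k oc)) IH big_cons.
Qed.

End green_kubo.

(** Regularity of L is a separate clause, because differentiating a C^r function F would yield less.
    No mean is prescribed for F, so that pairs are closed under products and can be centred
    afterwards. *)
Definition lie_pair F L := [/\ Cr1 r.+1 F, Cr1 r.+1 L,
  flow_derivative (Lam := Lam) (phi := phi) F L,
  (forall y, Lam y -> F (Rm *m y) = F y)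
  & (forall y, Lam y -> L (Rm *m y) = - L y)].

Lemma green_kubo_lie a F L : even_observable a -> lie_pair F L ->
  green_kubo a L = - 2 * I (fun y => a y * F y).
Proof.
move=> [Ca _ Ia] [CF CL FL _ _]; rewrite mulNr -mulrN /green_kubo; congr (_ * _).
apply/cvg_lim => //; apply: (cvg_Rintegral_corr cLam Cg flow muLam mixing) => //.
- exact: Cr1_bounded_measurable.
- exact: Cr1_continuous CF.
- exact: Cr1_continuous CL.
Qed.

Lemma eq_flow_derivative F F' L L' : F =1 F' -> L =1 L' ->
  flow_derivative (Lam := Lam) (phi := phi) F L ->
  flow_derivative (Lam := Lam) (phi := phi) F' L'.
Proof. by move=> /funext -> /funext ->. Qed.

Lemma flow_derivative_cst (k : R) : flow_derivative (Lam := Lam) (phi := phi) (fun=> k) (fun=> 0).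
Proof. by move=> y Ly t; exact: is_derive_cst. Qed.

Lemma flow_derivativeD F F' L L' : flow_derivative (Lam := Lam) (phi := phi) F L ->
  flow_derivative (Lam := Lam) (phi := phi) F' L' ->
  flow_derivative (Lam := Lam) (phi := phi) (fun y => F y + F' y) (fun y => L y + L' y).
Proof.
by move=> FL FL' y Ly t; have := FL y Ly t; have := FL' y Ly t => d' d; exact: is_deriveD.
Qed.

Lemma flow_derivativeM F F' L L' : flow_derivative (Lam := Lam) (phi := phi) F L ->
  flow_derivative (Lam := Lam) (phi := phi) F' L' ->
  flow_derivative (Lam := Lam) (phi := phi) (fun y => F y * F' y)
    (fun y => F y * L' y + F' y * L y).
Proof.
by move=> FL FL' y Ly t; have := FL y Ly t; have := FL' y Ly t => d' d; exact: is_deriveM.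
Qed.

Lemma flow_derivative_coord i :
  flow_derivative (Lam := Lam) (phi := phi) (fun y => y i 0) (fun y => g y i 0).
Proof. by move=> y Ly t; exact: (flow_derive flow). Qed.

Lemma flow_derivative_mulmx (M : 'M[R]_m) i :
  flow_derivative (Lam := Lam) (phi := phi)
    (fun y => (M *m y) i 0) (fun y => (M *m g y) i 0).
Proof.
suff sum : flow_derivative (Lam := Lam) (phi := phi)
    (fun y => \sum_j M i j * y j 0) (fun y => \sum_j M i j * g y j 0).
  by apply: eq_flow_derivative sum => y; rewrite mxE.
elim: (index_enum _) => [|j s IH].
  by apply: eq_flow_derivative (flow_derivative_cst 0) => y; rewrite big_nil.
have Mij := flow_derivativeM (flow_derivative_cst (M i j)) (flow_derivative_coord j).
apply: eq_flow_derivative (flow_derivativeD Mij IH) => y; rewrite big_cons//.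
by rewrite mulr0 addr0.
Qed.

Lemma lie_pairM F L F' L' : lie_pair F L -> lie_pair F' L' ->
  lie_pair (fun y => F y * F' y) (fun y => F y * L' y + F' y * L y).
Proof.
move=> [CF CL FL eF oL] [CF' CL' FL' eF' oL']; split.
- exact: Cr1M.
- by apply: Cr1D; exact: Cr1M.
- exact: flow_derivativeM.
- by move=> y Ly; rewrite eF// eF'.
- by move=> y Ly; rewrite eF// eF'// oL// oL'// !mulrN opprD.
Qed.

Lemma lie_pair_cst (k : R) : lie_pair (fun=> k) (fun=> 0).
Proof.
split=> //; [exact: Cr1_cst|exact: Cr1_cst|exact: flow_derivative_cst|].
by move=> y Ly; rewrite oppr0.
Qed.

Lemma lie_pairX F L n : lie_pair F L -> exists L', lie_pair (fun y => F y ^+ n) L'.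
Proof.
move=> FL; elim: n => [|n [L' IH]]; first by exists (fun=> 0); exact: lie_pair_cst.
exists (fun y => F y * L' y + F y ^+ n * L y).
rewrite (_ : (fun y => F y ^+ n.+1) = fun y => F y * F y ^+ n); first exact: lie_pairM.
by apply/funext => y; rewrite exprS.
Qed.

Lemma lie_pair_center F L k : lie_pair F L -> lie_pair (fun y => F y - k) L.
Proof.
move=> [CF CL FL eF oL]; split=> //.
- by apply: Cr1D => //; exact: Cr1_cst.
- by apply: eq_flow_derivative (flow_derivativeD FL (flow_derivative_cst (- k))) => y //; rewrite addr0.
- by move=> y Ly; rewrite eF.
Qed.

(** The candidates are the sum and the product of [y i 0] and [(Rm *m y) i 0]: being symmetric in
    the two, they are even. Their derivatives along the flow are explicit in [y] and [g y], and odd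
    because R g(R y) = - g(y) on [Lam]. *)
Lemma exists_lie_pair : exists F L, lie_pair F L /\ ~ finitely_supported (Lam := Lam) (mu := mu) F.
Proof.
have Cgi i : Cr1 r.+1 (fun y => g y i 0) by move/CrP : Cg; exact.
have CRg i : Cr1 r.+1 (fun y => (Rm *m g y) i 0).
  have : Cr1 r.+1 (fun y => \sum_j Rm i j * g y j 0).
    by apply: Cr1_sum => j; exact: Cr1Z.
  by congr Cr1; apply/funext => y; rewrite mxE.
have RRg y : Lam y -> Rm *m g (Rm *m y) = - g y.
  by move=> Ly; rewrite Rg// mulmxN involutionK.
have [i [nF|nF]] := exists_not_finitely_supported mixing ndirac cLam muLam (fun y => Rm *m y).
  exists (fun y : 'cV[R]_m => y i 0 + (Rm *m y) i 0), (fun y => g y i 0 + (Rm *m g y) i 0).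
  split=> //; split.
  - by apply: Cr1D; [exact: Cr1_coord|exact: Cr1_mulmx].
  - exact: Cr1D.
  - by apply: flow_derivativeD; [exact: flow_derivative_coord|exact: flow_derivative_mulmx].
  - by move=> y Ly; rewrite involutionK addrC.
  - by move=> y Ly; rewrite RRg// Rg// !mxE -opprD addrC.
exists (fun y : 'cV[R]_m => y i 0 * (Rm *m y) i 0),
  (fun y : 'cV[R]_m => y i 0 * (Rm *m g y) i 0 + (Rm *m y) i 0 * g y i 0).
split=> //; split.
- by apply: Cr1M; [exact: Cr1_coord|exact: Cr1_mulmx].
- by apply: Cr1D; apply: Cr1M => //; [exact: Cr1_coord|exact: Cr1_mulmx].
- by apply: flow_derivativeM; [exact: flow_derivative_coord|exact: flow_derivative_mulmx].
- by move=> y Ly; rewrite involutionK mulrC.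
- move=> y Ly; rewrite involutionK RRg// Rg//.
  by rewrite [(- g y) i 0]mxE [(- (Rm *m g y)) i 0]mxE !mulrN -opprD addrC.
Qed.

End observables.

(** * Dual families of observables *)

Lemma Rintegral_sum_lin d (T : measurableType d) (R : realType)
    (mu : probability T R) (D : set T) (J : Type) (s : seq J) (k : J -> R)
    (f : J -> T -> R) : measurable D ->
  (forall j, bounded_measurable D (f j)) ->
  bounded_measurable D (fun y => \sum_(j <- s) k j * f j y) /\
  (\int[mu]_(y in D) (\sum_(j <- s) k j * f j y) =
   \sum_(j <- s) k j * \int[mu]_(y in D) f j y)%R.
Proof.
move=> mD bf; elim: s => [|j s [IHb IH]].
  rewrite big_nil; under eq_fun do rewrite big_nil.
  by split; [exact: bounded_measurable_cst|rewrite Rintegral_cst// mul0r].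
rewrite big_cons; under eq_fun do rewrite big_cons.
by split; [exact: bounded_measurable_lin|rewrite Rintegral_lin// IH].
Qed.

(** Gaussian elimination writes M as a partial identity of size [\rank M] between two invertible
    factors; cancel these and cut out the k x k corner. *)
Lemma mxrank_identity (K : fieldType) (k N : nat) (M : 'M[K]_N) :
  (k <= \rank M)%N ->
  exists (a : 'M[K]_(k, N)) (b : 'M[K]_(N, k)), a *m M *m b = 1%:M.
Proof.
move=> kM; have MN := rank_leq_row M.
exists (pid_mx k *m invmx (col_ebase M)), (invmx (row_ebase M) *m pid_mx k).
rewrite -[X in _ *m X *m _](mulmx_ebase M) !mulmxA.
rewrite (mulmxKV (col_ebase_unit M)) (mulmxK (row_ebase_unit M)).
by rewrite !mul_pid_mx -[RHS]pid_mx_1; congr pid_mx; lia.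
Qed.

(* alpha is found in the left kernel of W and beta in the right kernel of U;
   the Frobenius rank inequality leaves rank dp for the pairing G between them. *)
Lemma dual_matrices (K : fieldType) (dp dm N : nat) (G : 'M[K]_N)
    (W : 'M[K]_(N, dm)) (U : 'M[K]_(dp, N)) :
  G \in unitmx -> (dp + dp + dm <= N)%N ->
  exists (alpha : 'M[K]_(dp, N)) (beta : 'M[K]_(N, dp)),
    [/\ alpha *m G *m beta = 1%:M, alpha *m W = 0 & U *m beta = 0].
Proof.
move=> uG leN; pose M := kermx W *m G *m cokermx U.
(* The kernel of W has rank at least N - dm and the cokernel of U at least N - dp, so Frobenius
   gives rank M >= N - dm - dp. This is where N >= 2 dp + dm comes from. *)
have rM : (dp <= \rank M)%N.
  have := mxrank_Frobenius (kermx W) G (cokermx U).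
  rewrite -/M (mxrankMfree _ _) ?row_free_unit// (mxrank_unit uG).
  have -> : \rank (G *m cokermx U) = \rank (cokermx U).
    by rewrite eqmxMfull ?row_full_unit.
  rewrite mxrank_ker mxrank_coker.
  have := rank_leq_col W; have := rank_leq_row U; lia.
have [a [b abM]] := mxrank_identity rM.
exists (a *m kermx W), (cokermx U *m b); split.
- by rewrite -abM /M !mulmxA.
- by rewrite -mulmxA mulmx_ker mulmx0.
- by rewrite mulmxA mulmx_coker mul0mx.
Qed.

Section dual_observables.
Context {R : realType} {m r : nat} {Lam : set 'cV[R]_m}
  {g : 'cV[R]_m -> 'cV[R]_m} {phi : R -> 'cV[R]_m -> 'cV[R]_m}
  {mu : probability (BorelcV R m) R} {Rm : 'M[R]_m}.
Hypotheses (cLam : compact Lam) (Cg : Cr r.+1 g) (flow : is_flow_on g Lam phi)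
  (muLam : mu Lam = 1%E) (mixing : flow_mixing mu Lam phi)
  (RmK : Rm *m Rm = 1%:M)
  (Rg : forall y, Lam y -> g (Rm *m y) = - (Rm *m g y))
  (ndirac : ~ is_dirac mu).

Let mLam : measurable (Lam : set (BorelcV R m)).
Proof. exact: compact_measurable_cV. Qed.

Local Notation bm := (@bounded_measurable _ (BorelcV R m) R Lam).
Local Notation I f := (Rintegral mu Lam f).
Local Notation even := (@even_observable R m r Lam mu Rm).
Local Notation odd := (@odd_observable R m r Lam Rm).
Local Notation lie_pair := (@lie_pair R m r Lam phi Rm).
Local Notation green_kubo := (@green_kubo R m Lam phi mu).

Lemma Rintegral_sqr_eq0 (h : 'cV[R]_m -> R) : bm h -> I (fun y => h y * h y) = 0 ->
  mu.-negligible (Lam `&` [set y | h y != 0] : set (BorelcV R m)).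
Proof.
move=> bh Ih.
have bhh : bm (fun y => h y * h y) by exact: bounded_measurable_mul.
have ihh := bounded_measurable_integrable mu mLam bhh.
have mhh := measurable_int mu ihh.
have int0 : (\int[mu]_(y in Lam) `|(h y * h y)%:E| = 0)%E.
  rewrite -[RHS]/(0%:E) -Ih /Rintegral fineK; last exact: integrable_fin_num.
  by apply: eq_integral => y _; rewrite /= ger0_norm// -expr2 sqr_ge0.
have := (ae_eq_integral_abs mu mLam mhh).1 int0.
apply: negligibleS => y [Ly /= hy] /(_ Ly) [] /eqP.
by rewrite mulf_eq0 orbb; exact/negP.
Qed.

(** A vector u in the kernel of the Gram matrix of centred powers of F gives h = sum_s u_s f_s with
    zero square integral. So h, a polynomial in F, vanishes almost everywhere; were u nonzero, F
    would take almost all its values among finitely many roots. *)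
Lemma exists_gram_unit N : exists (f L : 'I_N -> 'cV[R]_m -> R),
  [/\ forall s, even (f s), forall s, lie_pair (f s) (L s)
    & \matrix_(s, t) I (fun y => f s y * f t y) \in unitmx].
Proof.
have [F [L0 [FL0 nF]]] :=
  exists_lie_pair cLam Cg flow muLam mixing RmK Rg ndirac.
(* Exponents start at 1: the centred zeroth power is 0 and would make the Gram matrix singular. *)
pose mean (s : 'I_N) := I (fun y => F y ^+ s.+1).
have /choice[L LP] : forall s : 'I_N, exists L, lie_pair (fun y => F y ^+ s.+1) L.
  by move=> s; exact: lie_pairX FL0.
pose f (s : 'I_N) y := F y ^+ s.+1 - mean s.
have fL s : lie_pair (f s) (L s) by exact: lie_pair_center.
have bF (s : 'I_N) : bm (fun y => F y ^+ s.+1).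
  by have [CF _ _ _ _] := LP s; exact: Cr1_bounded_measurable CF.
have ef s : even (f s).
  have [Cf _ _ e_f _] := fL s; split=> //.
  rewrite (_ : f s = fun y => -1 * mean s + F y ^+ s.+1).
    have bc : bm (fun=> mean s) by exact: bounded_measurable_cst.
    rewrite (Rintegral_lin mu mLam (-1) bc (bF s)).
    by rewrite Rintegral_cst// [X in fine X]muLam mulr1 mulN1r addNr.
  by apply/funext => y; rewrite mulN1r addrC.
have bf s : bm (f s) by have [Cf _ _] := ef s; exact: Cr1_bounded_measurable Cf.
exists f, L; split=> //.
rewrite -row_free_unit -kermx_eq0; apply/rowV0P => u /sub_kermxP uG.
pose h y := \sum_s u 0 s * f s y.
have [bh _] := Rintegral_sum_lin mu (index_enum 'I_N) (fun s => u 0 s) mLam bf.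
have Ihh : I (fun y => h y * h y) = 0.
  have bhf t : bm (fun y => h y * f t y) by exact: bounded_measurable_mul.
  have [_ E] := Rintegral_sum_lin mu (index_enum 'I_N) (fun t => u 0 t) mLam bhf.
  rewrite (_ : (fun y => h y * h y) = fun y => \sum_t u 0 t * (h y * f t y)).
    rewrite E big1// => t _.
    have bff s : bm (fun y => f s y * f t y) by exact: bounded_measurable_mul.
    have [_ E2] := Rintegral_sum_lin mu (index_enum 'I_N) (fun s => u 0 s) mLam bff.
    rewrite (_ : (fun y => h y * f t y) = fun y => \sum_s u 0 s * (f s y * f t y)).
      rewrite E2 (_ : \sum_(s <- _) _ = (u *m \matrix_(s, t) I (fun y => f s y * f t y)) 0 t).
        by rewrite uG mxE mulr0.
      by rewrite mxE; apply: eq_bigr => s _; rewrite mxE.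
    by apply/funext => y; rewrite /h mulr_suml; apply: eq_bigr => s _; rewrite mulrA.
  by apply/funext => y; rewrite {2}/h mulr_sumr; apply: eq_bigr => s _; rewrite mulrCA.
have neg := Rintegral_sqr_eq0 bh Ihh.
apply: contrapT => u0; apply: nF.
pose P : {poly R} := \sum_s u 0 s *: ('X^(s.+1) - (mean s)%:P).
have PE y : P.[F y] = h y.
  by rewrite /P horner_sum; apply: eq_bigr => s _; rewrite !hornerE.
(* The means affect only the constant coefficient and the exponents are distinct and positive, so
   the coefficient of X^(s+1) is u_s. *)
have P0 : P != 0.
  apply/eqP => P0; apply: u0; apply/rowP => s; rewrite mxE.
  have := congr1 (fun p : {poly R} => p`_s.+1) P0.
  rewrite /P coef0 coef_sum (bigD1 s)//= big1 ?addr0.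
    by rewrite coefZ coefB coefXn eqxx coefC subr0 mulr1.
  move=> t ts; rewrite coefZ coefB coefXn coefC subr0 eqSS.
  by rewrite (_ : (s == t :> nat) = false) ?mulr0//; apply/negbTE; rewrite eq_sym.
have [l lP] := poly_roots_seq P0.
exists l; apply: negligibleS neg => y [Ly /= yl]; split=> //=.
by apply: contra yl => hy; apply: lP; rewrite /root PE.
Qed.

Hypothesis cvg_corr : forall a c, even a -> odd c ->
  cvg (corr_integral (Lam := Lam) (phi := phi) (mu := mu) a c T @[T --> +oo%R]).

(** Seek p in the span of the centred powers f_s and q in the span of their flow derivatives L_t.
    Their pairing matrix is -2 times the Gram matrix, hence invertible; [W] and [U] record the
    pairings that must vanish, and the rest is [dual_matrices]. Only dp pairs are needed, as the dm
    odd perturbations will be combinations of the q_k. *)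
Lemma exists_dual_observables dp dm (a0 : 'I_dp -> 'cV[R]_m -> R)
    (c0 : 'I_dm -> 'cV[R]_m -> R) :
  (forall i, even (a0 i)) -> (forall j, odd (c0 j)) ->
  exists p q : 'I_dp -> 'cV[R]_m -> R,
    [/\ (forall i, even (p i)), (forall k, odd (q k)),
        (forall i k, green_kubo (p i) (q k) = (i == k)%:R),
        (forall i j, green_kubo (p i) (c0 j) = 0)
      & (forall i k, green_kubo (a0 i) (q k) = 0)].
Proof.
move=> ea oc; set N := (dp + dp + dm)%N.
have [f [L [ef fL uG]]] := exists_gram_unit N.
have oL t : odd (L t) by have [_ CL _ _ oL] := fL t.
pose G : 'M[R]_N := \matrix_(s, t) green_kubo (f s) (L t).
have {}uG : G \in unitmx.
  have -> : G = (- 2) *: \matrix_(s, t) I (fun y => f s y * f t y).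
    apply/matrixP => s t; rewrite !mxE.
    exact: (green_kubo_lie cLam Cg flow muLam mixing (ef s) (fL t)).
  by rewrite unitmxZ// unitfE oppr_eq0 pnatr_eq0.
pose W : 'M[R]_(N, dm) := \matrix_(s, j) green_kubo (f s) (c0 j).
pose U : 'M[R]_(dp, N) := \matrix_(i, t) green_kubo (a0 i) (L t).
have [alpha [beta [aGb aW Ub]]] := dual_matrices W U uG (leqnn N).
pose p i y := \sum_s alpha i s * f s y.
pose q k y := \sum_t beta t k * L t y.
have ep i : even (p i) by exact: even_observable_sum.
have oq k : odd (q k) by exact: odd_observable_sum.
have gkl i c : odd c -> green_kubo (p i) c = \sum_s alpha i s * green_kubo (f s) c.
  by move=> oc'; exact: (green_kubo_suml cLam Cg flow cvg_corr).
have gkr a k : even a -> green_kubo a (q k) = \sum_t beta t k * green_kubo a (L t).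
  by move=> ea'; exact: (green_kubo_sumr cLam Cg flow cvg_corr).
exists p, q; split=> //.
- move=> i k; rewrite gkl//; transitivity ((alpha *m G *m beta) i k); last by rewrite aGb mxE.
  rewrite -mulmxA mxE; apply: eq_bigr => s _; rewrite gkr// mxE; congr (_ * _).
  by apply: eq_bigr => t _; rewrite !mxE mulrC.
- move=> i j; rewrite gkl//; transitivity ((alpha *m W) i j); last by rewrite aW mxE.
  by rewrite mxE; apply: eq_bigr => s _; rewrite mxE.
- move=> i k; rewrite gkr//; transitivity ((U *m beta) i k); last by rewrite Ub mxE.
  by rewrite mxE; apply: eq_bigr => t _; rewrite mxE mulrC.
Qed.

End dual_observables.

(** * Perturbation of an admissible function *)

Lemma iter_partial_0 (R : realType) (m n : nat) (s : seq 'I_m) :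
  iter_partial s (fun=> 0 : 'cV[R]_n) = (fun=> 0).
Proof.
elim: s => //= i s ->; apply/funext => x; exact: derive_cst.
Qed.

Section admissible_observables.
Context {R : realType} {m r : nat} {Lam : set 'cV[R]_m}
  {phi : R -> 'cV[R]_m -> 'cV[R]_m} {mu : probability (BorelcV R m) R}
  {Rm : 'M[R]_m} {dp dm : nat}.

Local Notation even := (@even_observable R m r Lam mu Rm).
Local Notation odd := (@odd_observable R m r Lam Rm).

Definition join_observables (a : 'I_dp -> 'cV[R]_m -> R)
    (c : 'I_dm -> 'cV[R]_m -> R) (y : 'cV[R]_m) : 'cV[R]_(dp + dm) :=
  col_mx (\col_i a i y) (\col_j c j y).

Lemma Amat_col_mx (u : 'cV[R]_dp) (w : 'cV[R]_dm) :
  Amat dp dm *m col_mx u w = col_mx u (- w).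
Proof. by rewrite /Amat mul_block_col !mul1mx !mul0mx addr0 add0r mulNmx mul1mx. Qed.

Lemma join_observables_l a c i y : join_observables a c y (lshift dm i) 0 = a i y.
Proof. by rewrite /join_observables col_mxEu mxE. Qed.

Lemma join_observables_r a c j y : join_observables a c y (rshift dp j) 0 = c j y.
Proof. by rewrite /join_observables col_mxEd mxE. Qed.

Lemma admissible_even v i : admissible r.+1 Lam mu Rm v ->
  even (fun y => usubmx (v y : 'cV[R]_(dp + dm)) i 0).
Proof.
move=> [/CrP Cv Av Iv]; split.
- have := Cv (lshift dm i); congr Cr1.
  by apply/funext => y; rewrite mxE.
- by move=> y Ly; rewrite Av// -[in LHS](vsubmxK (v y)) Amat_col_mx col_mxKu.
- have <- := Iv (lshift dm i); congr Rintegral.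
  by apply/funext => y; rewrite mxE.
Qed.

Lemma admissible_odd v j : admissible r.+1 Lam mu Rm v ->
  odd (fun y => dsubmx (v y : 'cV[R]_(dp + dm)) j 0).
Proof.
move=> [/CrP Cv Av _]; split.
- have := Cv (rshift dp j); congr Cr1.
  by apply/funext => y; rewrite mxE.
- move=> y Ly; rewrite Av// -[in LHS](vsubmxK (v y)) Amat_col_mx col_mxKd.
  by rewrite [LHS]mxE.
Qed.

Lemma admissible_join (a : 'I_dp -> 'cV[R]_m -> R) (c : 'I_dm -> 'cV[R]_m -> R) :
  (forall j, Rintegral mu Lam (c j) = 0) ->
  (forall i, even (a i)) -> (forall j, odd (c j)) ->
  admissible r.+1 Lam mu Rm (join_observables a c).
Proof.
move=> Ic ea oc.
have El i : (fun y => join_observables a c y (lshift dm i) 0) = a i.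
  by apply/funext => y; exact: join_observables_l.
have Er j : (fun y => join_observables a c y (rshift dp j) 0) = c j.
  by apply/funext => y; exact: join_observables_r.
split.
- apply/CrP => k; case: (split_ordP k) => i ->.
    by rewrite El; have [] := ea i.
  by rewrite Er; have [] := oc i.
- move=> y Ly; rewrite {2}/join_observables Amat_col_mx; congr col_mx.
    by apply/colP => i; rewrite !mxE; have [_ -> //] := ea i.
  by apply/colP => j; rewrite !mxE; have [_ -> //] := oc j.
- move=> k; case: (split_ordP k) => i ->.
    by rewrite El; have [] := ea i.
  by rewrite Er.
Qed.

Lemma chi_green_kubo v i j : chi Lam mu phi v i j =
  green_kubo (Lam := Lam) (phi := phi) (mu := mu)
    (fun y => usubmx (v y : 'cV[R]_(dp + dm)) i 0) (fun y => dsubmx (v y) j 0).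
Proof. by rewrite mxE. Qed.

End admissible_observables.

Unset Implicit Arguments.

Theorem theorem5p3 (R : realType) (m r : nat) (Lam : set 'cV[R]_m)
  (g : 'cV[R]_m -> 'cV[R]_m) (phi : R -> 'cV[R]_m -> 'cV[R]_m)
  (mu : probability (BorelcV R m) R) (Rm : 'M[R]_m) (dp dm : nat)
  (v0 : 'cV[R]_m -> 'cV[R]_(dp + dm)) :
  (1 <= r)%N ->
  compact Lam ->
  Cr r g ->
  is_flow_on g Lam phi ->
  mu Lam = 1%E ->
  flow_invariant mu Lam phi ->
  flow_ergodic mu Lam phi ->
  flow_mixing mu Lam phi ->
  Rm *m Rm = 1%:M ->
  (fun y => Rm *m y) @` Lam = Lam ->
  (forall A : set (BorelcV R m), measurable A ->
     mu ((fun y : 'cV[R]_m => Rm *m y) @^-1` A) = mu A) ->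
  (forall y, Lam y -> g (Rm *m y) = - (Rm *m g y)) ->
  ~ is_dirac mu ->
  (forall v : 'cV[R]_m -> 'cV[R]_(dp + dm), admissible r Lam mu Rm v ->
     forall i j, cvg (chi_partial Lam mu phi v i j T @[T --> +oo%R])) ->
  admissible r Lam mu Rm v0 ->
  forall K : set 'cV[R]_m, compact K ->
  forall eps : R, 0 < eps ->
  exists2 eta : R, 0 < eta &
    forall E : 'M[R]_(dp, dm),
      \rank E = minn dp dm ->
      `| E - chi Lam mu phi v0 | < eta ->
      exists v : 'cV[R]_m -> 'cV[R]_(dp + dm), [/\ admissible r Lam mu Rm v,
                    CrK_norm_lt r K (fun x => v x - v0 x) eps
                  & chi Lam mu phi v = E].
Proof.
case: r => [//|r] _ cLam Cg flow muLam _ _ mixing RmK RLam Rmu Rg ndirac Hcvg adm0.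
move=> K cK eps eps0.
(* If one dimension is 0, the matrices are empty and v0 itself works. Otherwise there is an entry of
   chi from which to read off convergence. *)
have [/andP[dp0 dm0]|d0] := boolP ((0 < dp) && (0 < dm))%N; last first.
  exists 1 => // E _ _; exists v0; split=> //.
    exists 0 => // s _ x _ k.
    rewrite (_ : (fun x => v0 x - v0 x) = fun=> 0) ?iter_partial_0 ?mxE ?normr0//.
    by apply/funext => y; rewrite subrr.
  apply/matrixP => i j; move: d0.
  by rewrite (leq_ltn_trans (leq0n i) (ltn_ord i)) (leq_ltn_trans (leq0n j) (ltn_ord j)).
have mean0 := @odd_observable_mean R m r Lam mu Rm cLam muLam RLam Rmu.
have cvg_corr a c : even_observable (r := r) (Lam := Lam) (mu := mu) (Rm := Rm) a ->
    odd_observable (r := r) (Lam := Lam) (Rm := Rm) c ->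
    cvg (corr_integral (Lam := Lam) (phi := phi) (mu := mu) a c T @[T --> +oo%R]).
  move=> ea oc.
  (* Repeating a and c in all coordinates gives an admissible function, so the assumed existence of
     chi yields convergence for every even-odd pair. *)
  have adm : admissible r.+1 Lam mu Rm (join_observables (fun _ : 'I_dp => a) (fun _ : 'I_dm => c)).
    by apply: admissible_join => // _; exact: mean0.
  have := Hcvg _ adm (Ordinal dp0) (Ordinal dm0).
  rewrite (_ : chi_partial _ _ _ _ _ _ =
    corr_integral (Lam := Lam) (phi := phi) (mu := mu) a c)//.
  apply/funext => T; congr Rintegral; apply/funext => t; congr Rintegral.
  by apply/funext => y; rewrite /join_observables col_mxKu col_mxKd !mxE.
pose a0 (i : 'I_dp) y := usubmx (v0 y) i 0.
pose c0 (j : 'I_dm) y := dsubmx (v0 y) j 0.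
have ea0 i := admissible_even i adm0.
have oc0 j := admissible_odd j adm0.
have [p [q [ep oq pq pc aq]]] := exists_dual_observables cLam Cg flow muLam
  mixing RmK Rg ndirac cvg_corr ea0 oc0.
have /choice[Mp MpP] : forall i, exists M, partials_bounded r.+1 K (p i) M.
  by move=> i; apply: Cr1_partials_bounded => //; have [] := ep i.
have /choice[Mq MqP] : forall k, exists M, partials_bounded r.+1 K (q k) M.
  by move=> k; apply: Cr1_partials_bounded => //; have [] := oq k.
(* [M] dominates each bound for p and the total bound for q; the 1 makes it positive. *)
pose M := \sum_i `|Mp i| + \sum_k `|Mq k| + 1.
have Mp0 : 0 <= \sum_i `|Mp i| by exact: sumr_ge0.
have Mq0 : 0 <= \sum_k `|Mq k| by exact: sumr_ge0.
have M0 : 0 < M by rewrite ltr_wpDl// addr_ge0.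
pose s := eps / (2 * M).
have s0 : 0 < s by rewrite divr_gt0// mulr_gt0.
have sM : s * M = eps / 2 by rewrite /s; field; rewrite lt0r_neq0.
(* The coefficients (E - E0) / s of the q_k are then at most [s], so both perturbations are bounded
   by s M = eps / 2. *)
exists (s ^+ 2); first exact: exprn_gt0.
move=> E _ Eeta; set E0 := chi Lam mu phi v0 in Eeta *.
pose D (j : 'I_dm) (k : 'I_dp) := (E - E0) k j / s.
have Ds j k : `|D j k| <= s.
  rewrite /D normrM normfV (gtr0_norm s0) ler_pdivrMr// -expr2.
  exact: le_trans (mx_norm_coord _ _ _) (ltW Eeta).
pose a i y := s * p i y + a0 i y.
pose c j y := 1 * (\sum_k D j k * q k y) + c0 j y.
have ea i : even_observable (r := r) (Lam := Lam) (mu := mu) (Rm := Rm) (a i).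
  exact: (even_observable_lin cLam s (ep i) (ea0 i)).
have oDq j : odd_observable (r := r) (Lam := Lam) (Rm := Rm) (fun y => \sum_k D j k * q k y).
  exact: odd_observable_sum.
have oc j : odd_observable (r := r) (Lam := Lam) (Rm := Rm) (c j).
  exact: (odd_observable_lin 1 (oDq j) (oc0 j)).
have adm : admissible r.+1 Lam mu Rm (join_observables a c).
  by apply: admissible_join => // j; exact: mean0.
exists (join_observables a c); split=> //.
- exists (eps / 2); first by rewrite ltr_pdivrMr// ltr_pMr// ltr1n.
  have [/CrP C _ _] := adm; have [/CrP C0 _ _] := adm0.
  have Cw : Cr r.+1 (fun x => join_observables a c x - v0 x).
    apply/CrP => k; have := Cr1D (C k) (Cr1Z (-1) (C0 k)); congr Cr1.
    by apply/funext => y; rewrite !mxE mulN1r.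
  move=> l lr x Kx k; rewrite (iter_partial_coord k x Cw lr) -sM.
  case: (split_ordP k) => i ->.
    have -> : (fun y => (join_observables a c y - v0 y) (lshift dm i) 0) =
        fun y => s * p i y + 0.
      by apply/funext => y; rewrite mxE join_observables_l /a /a0 !mxE addrK addr0.
    have Cp : Cr1 r.+1 (p i) by have [] := ep i.
    have := partials_bounded_lin s Cp (Cr1_cst r.+1 0) (MpP i) (@partials_bounded0 R m r.+1 K).
    move=> /(_ l lr x Kx)/le_trans; apply.
    rewrite addr0 (gtr0_norm s0) ler_wpM2l ?(ltW s0)// (le_trans (ler_norm _))//.
    rewrite /M (bigD1 i)//= -!addrA lerDl !addr_ge0 ?sumr_ge0//.
  have -> : (fun y => (join_observables a c y - v0 y) (rshift dp i) 0) =
      fun y => \sum_k D i k * q k y.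
    by apply/funext => y; rewrite mxE join_observables_r /c /c0 !mxE mul1r addrK.
  have Cq n : Cr1 r.+1 (q n) by have [] := oq n.
  have := partials_bounded_sum (index_enum 'I_dp) (D i) Cq MqP.
  move=> /(_ l lr x Kx)/le_trans; apply.
  apply: (@le_trans _ _ (s * \sum_k `|Mq k|)); last first.
    by rewrite ler_wpM2l ?(ltW s0)// /M addrAC lerDr addr_ge0.
  rewrite mulr_sumr ler_sum// => n _.
  by rewrite (le_trans (ler_norm _))// normrM normr_id ler_wpM2r.
- apply/matrixP => i j; rewrite chi_green_kubo.
  have -> : (fun y => usubmx (join_observables a c y) i 0) = a i.
    by apply/funext => y; rewrite col_mxKu mxE.
  have -> : (fun y => dsubmx (join_observables a c y) j 0) = c j.
    by apply/funext => y; rewrite col_mxKd mxE.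
  (* The four terms of the bilinear expansion: P pairs p_i with q, x pairs p_i with v0^-, Q pairs
     v0^+ with q, and y is the old value. Only s D_ji = (E - E0)_ij and y = (E0)_ij remain. *)
  have alg (x y : R) (P Q : 'I_dp -> R) : (forall k, P k = (i == k)%:R) ->
      (forall k, Q k = 0) -> x = 0 -> y = E0 i j ->
      s * (1 * (\sum_k D j k * P k) + x) + (1 * (\sum_k D j k * Q k) + y) = E i j.
    move=> PE QE -> ->.
    have -> : \sum_k D j k * P k = D j i.
      rewrite (bigD1 i)//= PE eqxx mulr1 big1 ?addr0// => k ki.
      by rewrite PE eq_sym (negbTE ki) mulr0.
    rewrite big1 => [|k _]; last by rewrite QE mulr0.
    rewrite /D mxE [(- E0) i j]mxE.
    by field; rewrite lt0r_neq0.
  pose GK := @green_kubo R m Lam phi mu.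
  have linr b (eb : even_observable (r := r) (Lam := Lam) (mu := mu) (Rm := Rm) b) :
      GK b (c j) = 1 * (\sum_k D j k * GK b (q k)) + GK b (c0 j).
    rewrite -(green_kubo_sumr cLam Cg flow cvg_corr _ (D j) eb oq).
    exact: (green_kubo_linr cLam Cg flow cvg_corr 1 eb (oDq j) (oc0 j)).
  rewrite -[LHS]/(GK (a i) (c j)).
  have -> : GK (a i) (c j) = s * GK (p i) (c j) + GK (a0 i) (c j).
    exact: (green_kubo_linl cLam Cg flow cvg_corr s (ep i) (ea0 i) (oc j)).
  rewrite (linr _ (ep i)) (linr _ (ea0 i)).
  apply: alg; [exact: pq|exact: aq|exact: pc|exact/esym/chi_green_kubo].
Qed.
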